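(* Let $\mathbb{H}$ be the sub-Finsler Heisenberg group equipped with a $C^1$ and strongly convex norm $\|\cdot\|$ and with a smooth measure $\mathfrak{m}$. Then $(\mathbb{H},\mathsf{d},\mathfrak{m})$ does not satisfy the Brunn–Minkowski inequality $\mathsf{BM}(K,N)$ for any $K\in\mathbb{R}$ and any $N\in(1,\infty)$.
   Context: Fix a norm $\|\cdot\|$ on $\mathbb{R}^2$. The sub-Finsler Heisenberg group $\mathbb{H}$ is $\mathbb{R}^3$ with group law $(x,y,z)\star(x',y',z')=(x+x',y+y',z+z'+\tfrac12(xy'-x'y))$, identity $\mathrm{e}=(0,0,0)$, and left-invariant vector fields $X_1=\partial_x-\tfrac{y}{2}\partial_z$, $X_2=\partial_y+\tfrac{x}{2}\partial_z$. A curve $\gamma:[0,1]\to\mathbb{R}^3$ is admissible if it is absolutely continuous and there is $u=(u_1,u_2)\in L^2([0,1];\mathbb{R}^2)$ with $\dot\gamma(t)=u_1(t)X_1(\gamma(t))+u_2(t)X_2(\gamma(t))$ for a.e. $t$; its length is $\int_0^1\|u(t)\|\,dt$. The sub-Finsler distance $\mathsf{d}(p,q)$ is the infimum of the lengths of admissible curves from $p$ to $q$. $\mathscr{L}^3$ denotes Lebesgue measure on $\mathbb{R}^3$; a Borel measure $\mathfrak{m}$ on $\mathbb{H}$ is smooth if $\mathfrak{m}=\rho\,\mathscr{L}^3$ with $\rho$ smooth and strictly positive. A geodesic in a metric space $(X,\mathsf{d})$ is a curve $\gamma:[0,1]\to X$ with $\mathsf{d}(\gamma(s),\gamma(t))=|t-s|\,\mathsf{d}(\gamma(0),\gamma(1))$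 for all $s,t\in[0,1]$. Regularity/convexity of the norm: with $f(x)=\tfrac12\|x\|^2$, the norm is called $C^1$ (resp. $C^2$) if it is of class $C^1$ (resp. $C^2$) on $\mathbb{R}^2\setminus\{0\}$, $C^{1,1}$ if $f$ is $C^1$ with Lipschitz gradient, strictly convex if $f$ is strictly convex, and strongly convex if there is $\alpha>0$ with $f(tx+(1-t)y)\le tf(x)+(1-t)f(y)-\tfrac{\alpha}{2}t(1-t)\|x-y\|^2$ for all $x,y\in\mathbb{R}^2$, $t\in[0,1]$. Brunn–Minkowski inequality: for $K\in\mathbb{R}$, $N\in(1,\infty)$, $t\in[0,1]$, $\theta\ge0$, let $\sigma^{(t)}_{K,N}(\theta)=+\infty$ if $N\pi^2\le K\theta^2$, $\sigma^{(t)}_{K,N}(\theta)=\sin(t\theta\sqrt{K/N})/\sin(\theta\sqrt{K/N})$ if $0<K\theta^2<N\pi^2$, $\sigma^{(t)}_{K,N}(\theta)=t$ if $K=0$, $\sigma^{(t)}_{K,N}(\theta)=\sinh(t\theta\sqrt{-K/N})/\sinh(\theta\sqrt{-K/N})$ if $K<0$; and $\tau^{(t)}_{K,N}(\theta)=t^{1/N}[\sigma^{(t)}_{K,N-1}(\theta)]^{1-1/N}$. For Borel sets $A,B$ and $t\in(0,1)$, $M_t(A,B)$ is the set of points $\gamma(t)$ where $\gamma$ is a geodesic with $\gamma(0)\in A$, $\gamma(1)\in B$. A metric measure space $(X,\mathsf d,\mathfrak m)$ satisfies $\mathsf{BM}(K,N)$ if for all nonempty Borel $A,B\subset\mathrm{spt}\,\mathfrak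 m$ and all $t\in(0,1)$, $\mathfrak m(M_t(A,B))^{1/N}\ge\tau^{(1-t)}_{K,N}(\Theta(A,B))\,\mathfrak m(A)^{1/N}+\tau^{(t)}_{K,N}(\Theta(A,B))\,\mathfrak m(B)^{1/N}$, where $\Theta(A,B)=\inf_{x\in A,y\in B}\mathsf d(x,y)$ if $K\ge0$ and $\Theta(A,B)=\sup_{x\in A,y\in B}\mathsf d(x,y)$ if $K<0$. *)

(* Defs.v *)
From HB Require Import structures.
From mathcomp Require Import all_boot all_order all_algebra.
From mathcomp Require Import all_classical all_reals all_analysis.
Set Implicit Arguments. Unset Strict Implicit. Unset Printing Implicit Defensive.
Import Order.TTheory GRing.Theory Num.Theory.
Import numFieldNormedType.Exports.
Local Open Scope classical_set_scope.
Local Open Scope ring_scope.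

Section Defs.
Variable R : realType.
Notation V2 := (R * R)%type.
Notation V3 := (R * R * R)%type.

Definition is_norm (nrm : V2 -> R) : Prop :=
  [/\ (forall x, nrm x = 0 -> x = 0),
      (forall (a : R) (x : V2), nrm (a *: x) = `|a| * nrm x) &
      (forall x y, nrm (x + y) <= nrm x + nrm y)].

(* C^1 on R^2 \ {0}: differentiable at every x <> 0, with differential
   x |-> 'd nrm x continuous there (continuity tested on each vector,
   i.e. entrywise, which is continuity in finite dimension). *)
Definition norm_C1 (nrm : V2 -> R) : Prop :=
  forall x : V2, x != 0 ->
    differentiable nrm x /\
    forall v : V2, {for x, continuous (fun y : V2 => 'd nrm y v)}.

Definition norm_strongly_convex (nrm : V2 -> R) : Prop :=
  let f := fun x => 2^-1 * nrm x ^+ 2 in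
  exists alpha : R, 0 < alpha /\
    forall (x y : V2) (t : R), 0 <= t <= 1 ->
      f (t *: x + (1 - t) *: y) <=
        t * f x + (1 - t) * f y - alpha / 2 * t * (1 - t) * nrm (x - y) ^+ 2.

Fixpoint iterD (vs : seq V3) (f : V3 -> R) : V3 -> R :=
  match vs with
  | [::] => f
  | v :: vs' => fun x => 'D_v (iterD vs' f) x
  end.

Definition smooth (f : V3 -> R) : Prop :=
  forall vs : seq V3,
    continuous (iterD vs f) /\ forall (v x : V3), derivable (iterD vs f) x v.

Fixpoint nonoverlapping (s : seq (R * R)) : bool :=
  match s with
  | [::] => true
  | ab :: s' => [&& 0 <= ab.1, ab.1 <= ab.2, ab.2 <= 1 &
                 if s' is cd :: _ then (ab.2 <= cd.1) && nonoverlapping s'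
                 else true]
  end.

Definition abs_cont01 (g : R -> R) : Prop :=
  forall eps : R, 0 < eps -> exists2 delta : R, 0 < delta &
    forall s : seq (R * R), nonoverlapping s ->
      \sum_(ab <- s) (ab.2 - ab.1) < delta ->
      \sum_(ab <- s) `|g ab.2 - g ab.1| < eps.

Definition L2_01 (f : R -> R) : Prop :=
  measurable_fun (`[0%R, 1%R]%classic : set R) f /\
  (\int[@lebesgue_measure R]_(t in (`[0%R, 1%R]%classic : set R)) ((f t) ^+ 2)%:E < +oo)%E.

(* gamma' = u1 X1(gamma) + u2 X2(gamma) a.e. on [0,1], with
   X1 = d_x - y/2 d_z, X2 = d_y + x/2 d_z *)
Definition admissible (gamma : R -> V3) (u : R -> V2) : Prop :=
  [/\ [/\ abs_cont01 (fun t => (gamma t).1.1),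
          abs_cont01 (fun t => (gamma t).1.2) &
          abs_cont01 (fun t => (gamma t).2)],
      L2_01 (fun t => (u t).1),
      L2_01 (fun t => (u t).2) &
      {ae @lebesgue_measure R, forall t, (`]0%R, 1%R[%classic : set R) t ->
        [/\ is_derive t 1 (fun s => (gamma s).1.1) (u t).1,
            is_derive t 1 (fun s => (gamma s).1.2) (u t).2 &
            is_derive t 1 (fun s => (gamma s).2)
              (- (gamma t).1.2 / 2 * (u t).1 + (gamma t).1.1 / 2 * (u t).2)]}].

Definition curve_length (nrm : V2 -> R) (u : R -> V2) : \bar R :=
  (\int[@lebesgue_measure R]_(t in (`[0%R, 1%R]%classic : set R)) (nrm (u t))%:E)%E.

Definition sF_dist (nrm : V2 -> R) (p q : V3) : \bar R :=
  ereal_inf [set L | exists gamma u, [/\ admissible gamma u, gamma 0 = p,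
                                          gamma 1 = q & L = curve_length nrm u]].

Definition geodesic (d : V3 -> V3 -> \bar R) (gamma : R -> V3) : Prop :=
  forall s t : R, 0 <= s <= 1 -> 0 <= t <= 1 ->
    d (gamma s) (gamma t) = (`|t - s|%:E * d (gamma 0%R) (gamma 1%R))%E.

Definition Mt (d : V3 -> V3 -> \bar R) (t : R) (A B : set V3) : set V3 :=
  [set x | exists gamma, [/\ geodesic d gamma, A (gamma 0), B (gamma 1)
                             & x = gamma t]].

Definition Leb3 := ((@lebesgue_measure R \x @lebesgue_measure R)
                      \x @lebesgue_measure R)%E.

Definition smooth_measure (rho : V3 -> R) (S : set V3) : \bar R :=
  (\int[Leb3]_(x in S) (rho x)%:E)%E.

(* outer measure (used on possibly non-measurable sets such as M_t(A,B)) *)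
Definition outer (m : set V3 -> \bar R) (S : set V3) : \bar R :=
  ereal_inf [set m E | E in [set E | measurable E /\ S `<=` E]].

Definition spt (d : V3 -> V3 -> \bar R) (m : set V3 -> \bar R) : set V3 :=
  [set x | forall r : R, 0 < r -> (0 < outer m [set y | (d x y < r%:E)%E])%E].

Definition sinh (x : R) : R := (expR x - expR (- x)) / 2.

Definition sigma_r (K N t th : R) : \bar R :=
  if K == 0 then t%:E
  else if N * pi ^+ 2 <= K * th ^+ 2 then +oo%E
  else if 0 < K * th ^+ 2 then
    (sin (t * th * Num.sqrt (K / N)) / sin (th * Num.sqrt (K / N)))%:E
  else if th == 0 then t%:E
  else (sinh (t * th * Num.sqrt (- K / N)) / sinh (th * Num.sqrt (- K / N)))%:E.

Definition sigma (K N t : R) (th : \bar R) : \bar R :=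
  match th with
  | th'%:E => sigma_r K N t th'
  | +oo%E => if K < 0 then 0%E else if K == 0 then t%:E else +oo%E
  | -oo%E => t%:E
  end.

Definition tau (K N t : R) (th : \bar R) : \bar R :=
  ((t `^ N^-1)%:E * poweR (sigma K (N - 1) t th) (1 - N^-1))%E.

Definition Theta (d : V3 -> V3 -> \bar R) (K : R) (A B : set V3) : \bar R :=
  if 0 <= K then ereal_inf [set d x y | x in A & y in B]
  else ereal_sup [set d x y | x in A & y in B].

Definition BM (d : V3 -> V3 -> \bar R) (m : set V3 -> \bar R) (K N : R) : Prop :=
  forall A B : set V3, measurable A -> measurable B ->
    A !=set0 -> B !=set0 -> A `<=` spt d m -> B `<=` spt d m ->
    forall t : R, 0 < t < 1 ->
      (tau K N (1 - t) (Theta d K A B) * poweR (m A) N^-1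
       + tau K N t (Theta d K A B) * poweR (m B) N^-1
       <= poweR (outer m (Mt d t A B)) N^-1)%E.

End Defs.

(* Main.v *)
(** In the direction where [s |-> nrm (1, s)] is minimal the norm is strongly
convex along the line x = 1 (this uses C^1).  Taking an almost extremal chord for
the best constant k of strong convexity, [nrm (1, s + .)] is, on some window
[-r, r], as close as we like (relatively to k r^2) to a quadratic polynomial
c0 + c1 t + k t^2 / 2; no second derivative is needed.  In the coordinates
x, y = x2 - s x1, w = z + x y / 2, in which horizontal curves satisfy dw = x dy,
the length is then c0 x' + c1 y' + (k / 2) y'^2 / x' up to that error, so that
distances between points at horizontal distance about 2 and transversal size O(r)
are computed by an explicit quadratic form: from above by the curve with slope
dy/dx affine in x, from below by a calibration valid for every admissible curve.
Hence midpoints of geodesics are close to the midpoints of these model curves.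
For p near (-1, 0, 0) and q near (1, 0, 0) the model midpoint is
y = (y_p + y_q) / 8 up to O(|w_p + y_p / 2| + |w_q - y_q / 2|): the midpoint set
of two suitable boxes of equal volume V lies in a box of volume less than
7 V / 10.  Dilating towards the identity makes the density of the measure almost
constant and the distortion coefficients tau almost 1 / 2, which contradicts
BM(K, N) for all K and N. *)
Require Import Defs.
From HB Require Import structures.
From mathcomp Require Import all_boot all_order all_algebra.
From mathcomp Require Import all_classical all_reals all_analysis.
From mathcomp Require Import measurable_realfun.
From mathcomp Require Import ring lra.
Set Implicit Arguments. Unset Strict Implicit. Unset Printing Implicit Defensive.
Import Order.TTheory GRing.Theory Num.Theory.
Import numFieldNormedType.Exports.
Local Open Scope classical_set_scope.
Local Open Scope ring_scope.

(** An error small relatively to k r^2 is enough for the following reason. If the calibration is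
    tilted by a slope of size d on the first half only, the deviation of a midpoint from the model
    curve appears multiplied by d, at a cost of order d^2 plus the window error eta r^2. Taking d =
    sqrt(eta) r bounds the deviation by a multiple of d, negligible beside the boxes, whose size is
    r / 100. This is the origin of eta = 10^-12 and d = r / 10^6.

    The factor 1/8: if w_p = - y_p / 2 and w_q = y_q / 2, the constraint dw = x dy fixes the
    integral of y over [-1, 1] to be (y_p + y_q) / 2; y is quadratic in x, so Simpson's rule is
    exact and gives y(0) = (y_p + y_q) / 8. For boxes of half-width a in y and a / 12 in the sheared
    w, the model midpoint has |y| at most a / 4 + a / 8 = 3 a / 8, while its x and w stay within the
    original half-widths. The volume ratio is thus about 3/8 before the error margins, whereas the
    inequality would force it to be close to 1 at least. *)

(** * Integrals of nonnegative functions; increments of absolutely continuous functions *)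

Section NonnegIntegral.
Import HBNNSimple.

(** The integral of a nonnegative function is a supremum over the simple functions below it, hence
    monotone for arbitrary functions. It is applied to speeds and densities whose measurability is
    never established. *)
Lemma nonneg_integral_le d (T : measurableType d) (R : realType)
    (mu : {measure set T -> \bar R}) (D : set T) (f g : T -> \bar R) :
  (forall x, D x -> (0 <= f x)%E) -> (forall x, D x -> (f x <= g x)%E) ->
  (\int[mu]_(x in D) f x <= \int[mu]_(x in D) g x)%E.
Proof.
move=> f0 fg.
have h0 : forall x, (0 <= (f \_ D) x)%E by apply: erestrict_ge0.
have fg' : forall x, ((f \_ D) x <= (g \_ D) x)%E by apply: lee_restrict.

rewrite (integral_mkcond D f) (integral_mkcond D g).
rewrite !ge0_integralTE//; last by move=> x; exact: le_trans (h0 x) (fg' x).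
apply: ereal_sup_le => _ [h hf <-].
exists h => // x.
exact: le_trans (hf x) (fg' x).
Qed.

(** A simple function below l f is l times a simple function below f. One inequality suffices for
    dilations, which are used with both l and its inverse. *)
Lemma nonneg_integralZ_le d (T : measurableType d) (R : realType) (mu : {measure set T -> \bar R})
    (D : set T) (f : T -> R) (l : R) : 0 < l -> (forall x, 0 <= f x) ->
  (\int[mu]_(x in D) (l * f x)%:E <= l%:E * \int[mu]_(x in D) (f x)%:E)%E.
Proof.
move=> l0 f0; have l0' := ltW l0.
rewrite (integral_mkcond D) [in leRHS](integral_mkcond D).
have f0' x : (0 <= ((EFin \o f) \_ D) x)%E by apply: erestrict_ge0 => y _; rewrite lee_fin.
rewrite !ge0_integralTE//; last by apply: erestrict_ge0 => y _; rewrite lee_fin mulr_ge0.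
apply: ge_ereal_sup => _ [h hh <-].
have li0 : 0 <= l^-1 by rewrite invr_ge0.
have -> : (sintegral mu h = l%:E * sintegral mu (scale_nnsfun h li0))%E.
  rewrite -sintegralrM; congr sintegral; apply/funext => x /=.
  by rewrite mulrA divff ?mul1r// gt_eqF.
rewrite lee_pmul2l//; apply: ereal_sup_ubound.
exists (scale_nnsfun h li0) => // x /=.
have := hh x; rewrite !patchE; case: ifP => _; rewrite !lee_fin.
  by rewrite -ler_pdivrMl.
by move=> ?; rewrite mulr_ge0_le0.
Qed.

End NonnegIntegral.

(* Continuous induction from the right endpoint: the differential inequality is used
   at the points outside U, the increments of H at the points of U. *)
Lemma ac_growth (R : realType) (H G : R -> R) (U : set R) (e c : R) :
  0 <= c <= 1 -> open U -> 0 <= e ->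
  {in `[c, 1] &, {homo G : x y / x <= y}} ->
  (forall t : R, c <= t <= 1 -> ~ U t -> exists2 r : R, 0 < r &
     forall s, `|s - t| < r ->
       (t <= s -> H s - H t <= G s - G t + e * (s - t)) /\
       (s <= t -> H t - H s <= G t - G s + e * (t - s))) ->
  exists s : seq (R * R), [/\ nonoverlapping s,
    ((\sum_(ab <- s) (ab.2 - ab.1))%:E <= @lebesgue_measure R U)%E &
    H 1 - H c <= G 1 - G c + e * (1 - c) + \sum_(ab <- s) `|H ab.2 - H ab.1| ].
Proof.
move=> /andP[c0 c1] oU e0 Gh loc.
have mU : measurable (U : set R) by exact: open_measurable.
(* The conclusion on [t, 1], strengthened for the induction: the listed intervals start after t, so
   that one more can be prepended, and their lengths are charged to the part of U right of t. *)
pose P (t : R) := c <= t <= 1 /\ exists s : seq (R * R), [/\ nonoverlapping s,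
    (if s is cd :: _ then t <= cd.1 else true),
    ((\sum_(ab <- s) (ab.2 - ab.1))%:E <= @lebesgue_measure R (U `&` `[t, 1%R[))%E &
    H 1 - H t <= G 1 - G t + e * (1 - t) + \sum_(ab <- s) `|H ab.2 - H ab.1| ].
have P1 : P 1.
  split; first by rewrite c1 lexx.
  by exists [::]; rewrite !big_nil !subrr mulr0 !addr0; split => //; rewrite measure_ge0.
have mI (a b : R) : measurable (`[a, b[%classic : set R) by exact: measurable_itv.
(* P passes from points just right of T to points just left of it. Outside U the inequality [loc] at
   T is used on both sides; inside U the interval [s, t] lies in U and is added to the list. *)
have step (T : R) : c <= T <= 1 -> exists2 r : R, 0 < r &
    forall t s, P t -> c <= s -> s <= T -> T <= t -> t < T + r -> T - r < s -> P s.
  move=> T01; have [UT|nUT] := pselect (U T); last first.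
    have [r r0 hr] := loc T T01 nUT.
    exists r => // t s [t01 [l [nl hd len hl]]] s0 sT Tt tr rs.
    split; first by case/andP: t01 => ? ?; lra.
    exists l; split => //.
    + by case: l hd {nl len hl} => //= cd _ ?; lra.
    + apply: le_trans len _; apply: le_measure; rewrite ?inE//; try exact: measurableI.
      apply: setIS => x /=; rewrite !in_itv/= => /andP[tx ->]; rewrite andbT; lra.
    + have [//|+ _] := hr t; first by rewrite ger0_norm; lra.
      have [//|_ +] := hr s; first by rewrite ler0_norm; lra.
      move=> /(_ sT) A1 /(_ Tt) A2; lra.
  have /nbhs_ballP[r /= r0 hr] := open_nbhs_nbhs (conj oU UT).
  exists r => // t s [t01 [l [nl hd len hl]]] s0 sT Tt tr rs.
  have t01' := t01; case/andP: t01' => t0 t1.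
  have stU : `[s, t[ `<=` U.
    move=> x /=; rewrite in_itv/= => /andP[sx xt]; apply: hr.
    by rewrite /ball/= ltr_norml; apply/andP; split; lra.
  split; first lra.
  exists ((s, t) :: l); rewrite !big_cons /=; split => //.
  + have Hn : if l is cd :: _ then (t <= cd.1) && nonoverlapping l else true.
      by case: (l) nl hd => // cd l' -> ->.
    by rewrite t1 (_ : 0 <= s) 1?(_ : s <= t) ?andbT /=; [case: (l) Hn|lra|lra].
  + rewrite EFinD (_ : U `&` `[s, 1[ = `[s, t[ `|` (U `&` `[t, 1[)); last first.
      apply/seteqP; split => x /=; rewrite !in_itv/=.
        move=> [Ux /andP[sx x1]]; case: (ltP x t) => xt; [left|right; split=>//]; rewrite ?sx ?x1//.
      case=> [/andP[sx xt]|[Ux /andP[tx x1]]].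
        split; first by apply: stU; rewrite /= in_itv/= sx xt.
        by rewrite sx/=; lra.
      by split=> //; rewrite x1 andbT; lra.
    rewrite measureU//.
    * apply: leeD => //; rewrite [X in (_ <= X)%E](lebesgue_measure_itv `[s, t[)/=; case: ifP => //.
      by rewrite lte_fin => /negbT; rewrite -leNgt => ?; rewrite lee_fin; lra.
    * exact: measurableI.
    * apply/seteqP; split => x //=; rewrite !in_itv/= => -[/andP[_ xt] [_ /andP[tx _]]].
      by move: xt; rewrite ltNge tx.
  + have Gst : G s <= G t by apply: Gh; rewrite ?in_itv/=; lra.
    have := ler_norm (H t - H s); move=> ?.
    have : 0 <= e * (t - s) by rewrite mulr_ge0//; lra.
    move=> ?; lra.
pose T := inf P.
have infP : has_inf P.
  split; [by exists 1 | by exists c => t [/andP[]]].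
have T01 : c <= T <= 1.
  apply/andP; split; last exact: ge_inf infP.2 _ P1.
  by apply: lb_le_inf infP.1 _ => t [/andP[]].
have [r r0 hr] := step T T01.
have [t Pt tT] : exists2 t, P t & t < T + r by exact: inf_adherent.
have Tt : T <= t by apply: ge_inf infP.2 _ Pt.
have [T0 T1] := andP T01.
(* This point lies below T unless T = c, in which case it is c itself. *)
have Ps : P (Num.max c (T - r / 2)).
  apply: (hr t) => //.
  - by rewrite le_max lexx.
  - by rewrite ge_max T0/=; lra.
  - rewrite lt_max; apply/orP; right; lra.
have := ge_inf infP.2 Ps; rewrite -/T le_max => /orP[T0'|]; last lra.
have TE : T = c by lra.
have P0 : P c.
  move: Ps; rewrite TE (_ : Num.max c (c - r/2) = c)//.
  by apply/max_idPl; lra.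
have [_ [l [nl _ len hl]]] := P0.
exists l; split; [exact: nl| |exact: hl].
apply: le_trans len _; apply: le_measure; rewrite ?inE//; exact: measurableI.
Qed.

Lemma is_derive_near (R : realType) (F : R -> R) (t d : R) :
  is_derive t 1 F d -> forall e : R, 0 < e -> exists2 r : R, 0 < r &
    forall s, `|s - t| < r -> `|F s - F t - d * (s - t)| <= e * `|s - t|.
Proof.
move=> [dF <-] e e0.
move: dF; rewrite /derivable => /cvg_ex[l hl].
have -> : 'D_1 F t = l by apply/cvg_lim.
move/cvgrPdist_le : hl => /(_ e e0) /nbhs_ballP[r /= r0 hr].
exists r => // s st.
have [->|sNt] := eqVneq s t; first by rewrite !subrr mulr0 subrr !normr0 mulr0.
have s0 : s - t != 0 by rewrite subr_eq0.
have := hr (s - t); rewrite /ball/= sub0r normrN => /(_ st s0).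
rewrite /GRing.scale/= mulr1 subrK => h1.
have -> : F s - F t - l * (s - t) = - ((l - (s - t)^-1 * (F s - F t)) * (s - t)) by field.
by rewrite normrN normrM ler_wpM2r.
Qed.

(** The antiderivative G of the positive part of h has derivative at least that of H outside a null
    set. An open neighbourhood of that set of small measure is where absolute continuity controls
    the increments of H. The free starting point c serves to bound the displacement along the tail
    of a curve. *)
Lemma ac_le_integral (R : realType) (H h : R -> R) (f : R -> \bar R) (c : R) :
  0 <= c <= 1 ->
  abs_cont01 H -> measurable_fun (`[0%R, 1%R]%classic : set R) h ->
  (forall t, 0 <= t <= 1 -> (0 <= f t)%E) ->
  (forall t, 0 <= t <= 1 -> ((h t)%:E <= f t)%E) ->
  {ae @lebesgue_measure R, forall t, (`]0%R, 1%R[%classic : set R) t ->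
     is_derive t 1 H (h t)} ->
  ((H 1 - H c)%:E <=
     \int[@lebesgue_measure R]_(t in (`[0%R, 1%R]%classic : set R)) f t)%E.
Proof.
move=> c01 acH mh f0 hf dH.
pose mu := @lebesgue_measure R.
pose D : set R := `[0%R, 1%R]%classic.
have mD : measurable D by exact: measurable_itv.
(* Truncation at 0 makes G nondecreasing, so that increments over the exceptional intervals can be
   discarded on the side of G. *)
pose g : R -> R := (fun t => Num.max (h t) 0) \_ D.
have mg : measurable_fun setT g.
  apply/(measurable_restrictT _ _).1 => //.
  by apply: measurable_maxr => //; exact: measurable_cst.
have g0 t : 0 <= g t by rewrite /g patchE; case: ifP => // _; rewrite le_max lexx orbT.
have gf : (\int[mu]_t (g t)%:E <= \int[mu]_(t in D) f t)%E.
  rewrite [leRHS]integral_mkcond; apply: nonneg_integral_le => t _; first by rewrite lee_fin.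
  rewrite /g !patchE; case: ifPn => // /set_mem; rewrite /D/= in_itv/= => tD.
  by rewrite EFin_max ge_max hf// f0.
have [foo|foo] := eqVneq (\int[mu]_(t in D) f t)%E +oo%E; first by rewrite foo leey.
have goo : (\int[mu]_t (g t)%:E < +oo)%E by apply: le_lt_trans gf _; rewrite ltey.
have ig : mu.-integrable setT (EFin \o g).
  apply/integrableP; split; first exact/measurable_EFinP.
  under eq_integral do rewrite gee0_abs ?lee_fin//; exact: goo.
have igy (y : R) : mu.-integrable `]-oo, y] (EFin \o g).
  by apply: integrableS ig => //; exact: measurable_itv.
have lg : locally_integrable [set: R] g.
  by have := integrable_locally measurableT ig; rewrite patch_setT.
have := FTC1Ny igy lg.
set G := (G in let F := G in _) => /= dG.
have Gh (x y : R) : x <= y -> G x <= G y.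
  move=> xy; apply: fine_le; try exact: integrable_fin_num.
  apply: ge0_subset_integral => //.
  - by apply/measurable_EFinP; exact: measurable_funTS.
  - by move=> t _; rewrite lee_fin.
  - by apply: subset_itvl; rewrite bnd_simp.
have G1 : ((G 1)%:E <= \int[mu]_t (g t)%:E)%E.
  rewrite /G/Rintegral fineK; last exact: integrable_fin_num (igy 1).
  apply: ge0_subset_integral => //; first exact/measurable_EFinP.
  by move=> t _; rewrite lee_fin.
have G0 : 0 <= G c by apply: fine_ge0; apply: integral_ge0 => t _; rewrite lee_fin.
apply: le_trans gf; apply: le_trans G1; rewrite lee_fin.
suff key : forall e : R, 0 < e -> H 1 - H c <= G 1 + 2 * e.
  rewrite leNgt; apply/negP => lt.
  by have := key ((H 1 - H c - G 1) / 4); lra.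
move=> e e0.
have [dl dl0 hdl] := acH e e0.
(* The endpoints join the exceptional set because the derivative of H is known on the open interval
   only. *)
have bad : {ae mu, forall t, [/\ (`]0%R, 1%R[%classic : set R) t -> is_derive t 1 H (h t),
     derivable G t 1 /\ G^`()%classic t = g t, t != 0 & t != 1]}.
  have n1 (a : R) : {ae mu, forall t, t != a}.
    exists [set a]; split; [by []|exact: lebesgue_measure_set1|].
    by move=> t /= /negP; rewrite negbK => /eqP.
  have F := ae_filter_ringOfSetsType (@lebesgue_measure R).
  have := @filterI _ _ F _ _ (@filterI _ _ F _ _ dH dG) (@filterI _ _ F _ _ (n1 0) (n1 1)).
  by apply: (@filterS _ _ F) => t [[? ?] [? ?]]; split.
case: bad => Z [mZ Z0 badZ].
have [U [oU ZU muU]] : exists U : set R, [/\ open U, Z `<=` U & (mu (U `\` Z) < dl%:E)%E].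
  by apply: lebesgue_regularity_outer => //; rewrite [X in (X < _)%E]Z0.
have mU : measurable (U : set R) by exact: open_measurable.
have muU' : (mu U < dl%:E)%E.
  apply: le_lt_trans muU.
  have mUZ : measurable (U `\` Z) by exact: measurableD.
  rewrite -{1}(setDUK ZU); apply: le_trans (measureU2 _ mZ mUZ) _.
  by rewrite [X in (X + _)%E]Z0 add0e.
have [] := @ac_growth R H G U e c c01 oU (ltW e0).
- by move=> x y _ _; exact: Gh.
- move=> t tc1 nU.
  have t01 : 0 <= t <= 1 by have [? ?] := andP c01; case/andP: tc1 => ? ?; lra.
  have : ~ Z t by move=> Zt; apply: nU; exact: ZU.
  move=> nZ; have [dHt [dGt Gt] t0 t1] : [/\ (`]0%R, 1%R[%classic : set R) t -> is_derive t 1 H (h t),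
     derivable G t 1 /\ G^`()%classic t = g t, t != 0 & t != 1].
    by apply: contrapT => ct; apply: nZ; exact: badZ.
  have tD : (`]0%R, 1%R[%classic : set R) t.
    by case/andP: t01 => a b; rewrite /= in_itv/= !lt_neqAle eq_sym t0 t1 a b.
  have {}dHt := dHt tD.
  have {}dGt : is_derive t 1 G (g t) by apply: DeriveDef; [exact: dGt|rewrite -Gt derive1E].
  have hg : h t <= g t.
    rewrite /g patchE mem_set ?le_max ?lexx//; exact: subset_itv_oo_cc tD.
  have dF : is_derive t 1 (H - G) (h t - g t) by exact: is_deriveB.
  have [r r0 hr] := is_derive_near dF e0.
  exists r => // s /hr; rewrite !fctE ler_norml => /andP[k1 k2]; split => ts.
  + rewrite (ger0_norm (_ : 0 <= s - t)) in k2; last by rewrite subr_ge0.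
    have : (h t - g t) * (s - t) <= 0 by apply: mulr_le0_ge0; rewrite ?subr_le0 ?subr_ge0.
    by move: k1 k2; clear; lra.
  + rewrite (ler0_norm (_ : s - t <= 0)) in k1; last by rewrite subr_le0.
    have : (h t - g t) * (t - s) <= 0 by apply: mulr_le0_ge0; rewrite ?subr_le0 ?subr_ge0.
    by move: k1 k2; clear; lra.
- move=> l [nl len hl].
  have : \sum_(ab <- l) (ab.2 - ab.1) < dl.
    by rewrite -lte_fin; apply: le_lt_trans len _.
  move=> /(hdl _ nl) ?; have [c0 c1] := andP c01.
  have : e * (1 - c) <= e by rewrite ler_piMr ?(ltW e0)//; lra.
  move=> ?; lra.
Qed.

Lemma nonoverlapping_mem (R : realType) (s : seq (R * R)) :
  nonoverlapping s -> forall ab, ab \in s -> [/\ 0 <= ab.1, ab.1 <= ab.2 & ab.2 <= 1].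
Proof.
elim: s => // cd s IH /= /and4P[h1 h2 h3 h4] ab; rewrite inE => /orP[/eqP->//|abs].
by apply: IH abs; case: (s) h4 => // ? ? /andP[].
Qed.

(** * Calculus of absolutely continuous functions *)

Section AbsCont.
Variable R : realType.
Implicit Types f g h : R -> R.

(** Common source of the closure properties: sums, multiples, products of bounded functions and
    Lipschitz functions all have increments dominated in this way. *)
Lemma abs_cont01_le f g h (C : R) :
  abs_cont01 f -> abs_cont01 g ->
  (forall a b, 0 <= a -> a <= b -> b <= 1 ->
     `|h b - h a| <= C * (`|f b - f a| + `|g b - g a|)) ->
  abs_cont01 h.
Proof.
move=> af ag hh e e0.
pose C' := `|C| + 1.
have C'0 : 0 < C' by rewrite ltr_wpDl.
have e'0 : 0 < e / C' / 2 by rewrite !divr_gt0.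
have [d1 d10 h1] := af _ e'0; have [d2 d20 h2] := ag _ e'0.
exists (Num.min d1 d2); first by rewrite lt_min d10.
move=> s ns; rewrite lt_min => /andP[s1 s2].
have := h1 s ns s1; have := h2 s ns s2 => k2 k1.
apply: (@le_lt_trans _ _ (C' * (\sum_(ab <- s) `|f ab.2 - f ab.1| + \sum_(ab <- s) `|g ab.2 - g ab.1|))).
  rewrite -big_split/= mulr_sumr big_seq [leRHS]big_seq; apply: ler_sum => ab /(nonoverlapping_mem ns)[? ? ?].
  apply: le_trans (hh _ _ _ _ _) _ => //; apply: ler_wpM2r; first by rewrite addr_ge0.
  by rewrite /C'; have := ler_norm C; lra.
rewrite -ltr_pdivlMl// mulrC; lra.
Qed.

Lemma abs_cont01_cst (a : R) : abs_cont01 (fun=> a).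
Proof.
move=> e e0; exists 1 => // s _ _.
by rewrite big1_seq// => ab _; rewrite subrr normr0.
Qed.

Lemma abs_cont01D f g : abs_cont01 f -> abs_cont01 g -> abs_cont01 (fun t => f t + g t).
Proof.
move=> af ag; apply: (abs_cont01_le (C := 1) af ag) => a b _ _ _.
rewrite mul1r (_ : _ - _ = f b - f a + (g b - g a)); [exact: ler_normD|ring].
Qed.

Lemma abs_cont01Z (c : R) f : abs_cont01 f -> abs_cont01 (fun t => c * f t).
Proof.
move=> af; apply: (abs_cont01_le (C := `|c|) af af) => a b _ _ _.
by rewrite -mulrBr normrM ler_wpM2l// ler_wpDr.
Qed.

Lemma abs_cont01_near f : abs_cont01 f -> forall e : R, 0 < e -> exists2 r : R, 0 < r &
  forall a b, 0 <= a <= 1 -> 0 <= b <= 1 -> `|a - b| < r -> `|f a - f b| < e.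
Proof.
move=> af e e0; have [d d0 hd] := af e e0; exists d => //.
suff K a b : 0 <= a <= 1 -> 0 <= b <= 1 -> a <= b -> `|a - b| < d -> `|f a - f b| < e.
  move=> a b a01 b01; have [ab|/ltW ba] := leP a b; first exact: K.
  by rewrite distrC (distrC (f a)); exact: K.
move=> /andP[a0 a1] /andP[b0 b1] ab; rewrite distrC ger0_norm ?subr_ge0// => abd.
have := hd [:: (a, b)]; rewrite !big_seq1/= distrC; apply => //.
by rewrite a0 ab b1.
Qed.

Lemma abs_cont01_continuous f : abs_cont01 f -> {within `[0%R, 1%R], continuous f}.
Proof.
move=> af; apply/subspace_continuousP => x x01; apply/cvgrPdist_lt => e e0.
have [r r0 hr] := abs_cont01_near af e0.
rewrite near_withinE; apply/nbhs_ballP; exists r => //= y; rewrite /ball/= => xy y01.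
by apply: hr => //; rewrite -in_itv.
Qed.

Lemma abs_cont01_measurable f : abs_cont01 f ->
  measurable_fun (`[0%R, 1%R]%classic : set R) f.
Proof.
move=> af; apply: subspace_continuous_measurable_fun; first exact: measurable_itv.
exact: abs_cont01_continuous.
Qed.

Lemma abs_cont01_bounded f : abs_cont01 f ->
  exists M : R, forall t, 0 <= t <= 1 -> `|f t| <= M.
Proof.
move=> /abs_cont01_continuous cf.
have [c _ hc] := EVT_max (@ler01 R) cf; have [d _ hd] := EVT_min (@ler01 R) cf.
exists (`|f c| + `|f d|) => t t01; have t01' : t \in `[0, 1] by rewrite in_itv.
have := hc t t01'; have := hd t t01'; have := ler_norm (f c); have := ler_norm (- f d).
have := normr_ge0 (f c); have := normr_ge0 (f d).
by rewrite normrN ler_norml => *; apply/andP; split; lra.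
Qed.

Lemma abs_cont01M f g : abs_cont01 f -> abs_cont01 g -> abs_cont01 (fun t => f t * g t).
Proof.
move=> af ag; have [M hM] := abs_cont01_bounded af; have [K hK] := abs_cont01_bounded ag.
have M0 : 0 <= M by apply: le_trans (hM 0 _) => //; rewrite lexx ler01.
have K0 : 0 <= K by apply: le_trans (hK 0 _) => //; rewrite lexx ler01.
apply: (abs_cont01_le (C := M + K) af ag) => a b a0 ab b1.
rewrite (_ : _ - _ = f b * (g b - g a) + (f b - f a) * g a); last by ring.
apply: le_trans (ler_normD _ _) _; rewrite !normrM.
have b01 : 0 <= b <= 1 by apply/andP; split; lra.
have a01 : 0 <= a <= 1 by apply/andP; split; lra.
have k1 : `|f b| * `|g b - g a| <= (M + K) * `|g b - g a|.
  by apply: ler_wpM2r => //; have := hM b b01; lra.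
have k2 : `|f b - f a| * `|g a| <= (M + K) * `|f b - f a|.
  by rewrite mulrC; apply: ler_wpM2r => //; have := hK a a01; lra.
by rewrite mulrDr; lra.
Qed.

Lemma lipschitz_abs_cont01 f (C : R) :
  (forall a b, 0 <= a -> a <= b -> b <= 1 -> `|f b - f a| <= C * (b - a)) -> abs_cont01 f.
Proof.
move=> hf; have aid : abs_cont01 (@id R).
  move=> e e0; exists e => // s ns; apply: le_lt_trans; rewrite big_seq [leRHS]big_seq.
  by apply: ler_sum => ab /(nonoverlapping_mem ns)[? ? ?]; rewrite ger0_norm// subr_ge0.
apply: (abs_cont01_le (C := `|C|) (abs_cont01_cst 0) aid) => a b a0 ab b1.
apply: le_trans (hf _ _ a0 ab b1) _.
rewrite subrr normr0 add0r (@ger0_norm _ (b - a)) ?subr_ge0//.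
by apply: ler_wpM2r; [rewrite subr_ge0|exact: ler_norm].
Qed.

End AbsCont.

(** * Lower bound for the distance by calibration *)

Section LowerBound.
Variable R : realType.
Implicit Types (nrm : R * R -> R) (p q : R * R * R).

(* The last two coordinates; along horizontal curves the derivative of [wco] is x
   times that of [yco]. *)
Definition yco (s : R) p : R := p.1.2 - s * p.1.1.
Definition wco (s : R) p : R := p.2 + p.1.1 * yco s p / 2.

(* Calibration: with tau = al + be x, its derivative along a horizontal curve is
   c0 x' + c1 y' + k (tau y' - tau^2 x' / 2), which is almost bounded by the speed
   when tau lies in the window. *)
Definition pot (s c0 c1 k al be : R) p : R :=
  c0 * p.1.1 + c1 * yco s p + k * (al * yco s p + be * wco s p
    - (al ^+ 2 * p.1.1 + al * be * p.1.1 ^+ 2 + be ^+ 2 * p.1.1 ^+ 3 / 3) / 2).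

Lemma is_deriveMf (f g : R -> R) (t df dg : R) :
  is_derive t 1 f df -> is_derive t 1 g dg ->
  is_derive t 1 (fun s => f s * g s) (f t * dg + g t * df).
Proof. by move=> hf hg; have := is_deriveM hf hg. Qed.

Lemma is_deriveDf (f g : R -> R) (t df dg : R) :
  is_derive t 1 f df -> is_derive t 1 g dg ->
  is_derive t 1 (fun s => f s + g s) (df + dg).
Proof. by move=> hf hg; have := is_deriveD hf hg. Qed.

Lemma is_deriveZf (c : R) (f : R -> R) (t df : R) :
  is_derive t 1 f df -> is_derive t 1 (fun s => c * f s) (c * df).
Proof. by move=> hf; have := is_deriveZ c hf. Qed.

Lemma is_derive_pot (s c0 c1 k al be t u1 u2 : R) (g : R -> R * R * R) :
  is_derive t 1 (fun r => (g r).1.1) u1 ->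
  is_derive t 1 (fun r => (g r).1.2) u2 ->
  is_derive t 1 (fun r => (g r).2) (- (g t).1.2 / 2 * u1 + (g t).1.1 / 2 * u2) ->
  is_derive t 1 (fun r => pot s c0 c1 k al be (g r))
    (c0 * u1 + c1 * (u2 - s * u1) + k * ((al + be * (g t).1.1) * (u2 - s * u1)
       - (al + be * (g t).1.1) ^+ 2 * u1 / 2)).
Proof.
move=> hx hy hz.
pose x r := (g r).1.1; pose y r := (g r).1.2; pose z r := (g r).2.
rewrite [X in is_derive _ _ X _](_ : _ = fun r =>
   (c0 - c1 * s - k * al * s - k * al ^+ 2 / 2) * x r + ((c1 + k * al) * y r +
   (k * be * z r + (k * be / 2 * (x r * y r) +
   ((- (k * be * s / 2) - k * al * be / 2) * (x r * x r)
   + (- (k * be ^+ 2 / 6)) * (x r * (x r * x r))))))); last first.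
  by apply/funext => r; rewrite /pot /wco /yco /x /y /z; field.
have D := is_deriveDf (is_deriveZf (c0 - c1 * s - k * al * s - k * al ^+ 2 / 2) hx)
  (is_deriveDf (is_deriveZf (c1 + k * al) hy)
  (is_deriveDf (is_deriveZf (k * be) hz)
  (is_deriveDf (is_deriveZf (k * be / 2) (is_deriveMf hx hy))
  (is_deriveDf (is_deriveZf (- (k * be * s / 2) - k * al * be / 2) (is_deriveMf hx hx))
  (is_deriveZf (- (k * be ^+ 2 / 6)) (is_deriveMf hx (is_deriveMf hx hx))))))).
apply: (is_derive_eq D).
by rewrite /x /y; field.
Qed.

Lemma abs_cont01_pot (s c0 c1 k al be : R) (g : R -> R * R * R) :
  abs_cont01 (fun r => (g r).1.1) -> abs_cont01 (fun r => (g r).1.2) ->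
  abs_cont01 (fun r => (g r).2) -> abs_cont01 (fun r => pot s c0 c1 k al be (g r)).
Proof.
move=> hx hy hz.
pose x r := (g r).1.1; pose y r := (g r).1.2; pose z r := (g r).2.
rewrite (_ : (fun _ => _) = fun r =>
   (c0 - c1 * s - k * al * s - k * al ^+ 2 / 2) * x r + ((c1 + k * al) * y r +
   (k * be * z r + (k * be / 2 * (x r * y r) +
   ((- (k * be * s / 2) - k * al * be / 2) * (x r * x r)
   + (- (k * be ^+ 2 / 6)) * (x r * (x r * x r))))))); last first.
  by apply/funext => r; rewrite /pot /wco /yco /x /y /z; field.
apply: abs_cont01D; first exact: abs_cont01Z hx.
apply: abs_cont01D; first exact: abs_cont01Z hy.
apply: abs_cont01D; first exact: abs_cont01Z hz.
apply: abs_cont01D; first exact: abs_cont01Z (abs_cont01M hx hy).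
apply: abs_cont01D; first exact: abs_cont01Z (abs_cont01M hx hx).
exact: abs_cont01Z (abs_cont01M hx (abs_cont01M hx hx)).
Qed.

(** Along a competitor of length at most D', the coordinate x stays within D' / cx of its final
    value, so the slope al + be x never leaves the window and the derivative of [pot] is at most the
    speed plus eps |x'|. Since cx |x'| is at most the speed, the error costs the factor 1 + eps /
    cx. *)
Lemma lower_bound nrm (s c0 c1 k eps cx rho al be D D' : R) p q :
  (forall v, 0 <= nrm v) -> 0 < cx -> 0 <= eps ->
  (forall x y, cx * `|x| <= nrm (x, y)) ->
  (forall tau, `|tau| <= rho -> forall x y,
     c0 * x + c1 * y + k * (tau * y - tau ^+ 2 * x / 2) <= nrm (x, s * x + y) + eps * `|x|) ->
  D < D' -> (forall x, cx * `|q.1.1 - x| <= D' -> `|al + be * x| <= rho) ->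
  (sF_dist nrm p q <= D%:E)%E ->
  cx * `|q.1.1 - p.1.1| <= D /\
  pot s c0 c1 k al be q - pot s c0 c1 k al be p <= (1 + eps / cx) * D.
Proof.
move=> n0 cx0 e0 hx hL DD' hr dD.
have C0 : 0 < 1 + eps / cx by rewrite ltr_wpDr ?divr_ge0// ltW.
(* The infimum defining the distance need not be attained: curves of length L slightly above D are
   used, and L then tends to D. *)
suff key (L : R) : D < L -> L <= D' ->
  cx * `|q.1.1 - p.1.1| <= L /\
  pot s c0 c1 k al be q - pot s c0 c1 k al be p <= (1 + eps / cx) * L.
  split.
    rewrite leNgt; apply/negP => lt.
    have [//|//|h _] := key (Num.min D' ((D + cx * `|q.1.1 - p.1.1|) / 2)).
    - by rewrite lt_min DD'; lra.
    - by rewrite ge_min lexx.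
    - by move: h; rewrite le_min => /andP[]; lra.
  set P := pot _ _ _ _ _ _ _ - _ in key *.
  rewrite -ler_pdivrMl// leNgt; apply/negP => lt.
  set Q := _ * P in lt.
  have [//|//|_] := key (Num.min D' ((D + Q) / 2)).
  - by rewrite lt_min DD'; lra.
  - by rewrite ge_min lexx.
  - by rewrite -ler_pdivrMl// -/Q le_min => /andP[]; lra.
move=> DL LD'.
have dL : (sF_dist nrm p q < L%:E)%E by apply: le_lt_trans dD _; rewrite lte_fin.
have [l [g [u [adm gp gq lE]]] lenL] := ereal_inf_lt dL.
rewrite {}lE in lenL.
have [[ax ay az] l2u1 l2u2 ae] := adm.
have mu1 := l2u1.1; have mu2 := l2u2.1.
have f0 t : 0 <= t <= 1 -> (0 <= (nrm (u t))%:E)%E by move=> _; rewrite lee_fin.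
have u1n t : cx * `|(u t).1| <= nrm (u t) by case: (u t).
have dx : {ae @lebesgue_measure R, forall t, (`]0%R, 1%R[%classic : set R) t ->
     is_derive t 1 (fun r => (g r).1.1) (u t).1}.
  by apply: (@filterS _ _ (ae_filter_ringOfSetsType (@lebesgue_measure R))) ae => t + tt => /(_ tt) [].
(* Both signs of the displacement are bounded by comparing e cx x(t), with e = 1 or -1, to the
   length. *)
have range t : 0 <= t <= 1 -> cx * `|(g 1).1.1 - (g t).1.1| <= L.
  move=> t01.
  have K (e : R) : `|e| = 1 -> e * cx * ((g 1).1.1 - (g t).1.1) <= L.
    move=> e1.
    rewrite -lee_fin; apply: le_trans (ltW lenL); rewrite mulrBr.
    apply: (@ac_le_integral _ (fun r => e * cx * (g r).1.1) (fun r => e * cx * (u r).1) (fun t => (nrm (u t))%:E)) => //.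
    - exact: abs_cont01Z.
    - apply: measurable_funM => //; exact: measurable_cst.
    - move=> r _; rewrite lee_fin; apply: le_trans (u1n r).
      by apply: le_trans (ler_norm _) _; rewrite !normrM e1 mul1r gtr0_norm.
    - apply: (@filterS _ _ (ae_filter_ringOfSetsType (@lebesgue_measure R))) dx => r + rr => /(_ rr); exact: is_deriveZf.
  have := K 1 (normr1 _); have := K (-1); rewrite normrN1 => /(_ erefl).
  by case: (ger0P ((g 1).1.1 - (g t).1.1)) => _; clear; lra.
split; first by rewrite -gp -gq; apply: range; rewrite lexx ler01.
rewrite -ler_pdivrMl// -gp -gq -lee_fin; apply: le_trans (ltW lenL); rewrite mulrBr.
apply: (@ac_le_integral _ (fun r => (1 + eps / cx)^-1 * pot s c0 c1 k al be (g r))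
  (fun t => (1 + eps / cx)^-1 * (c0 * (u t).1 + c1 * ((u t).2 - s * (u t).1) +
      k * ((al + be * (g t).1.1) * ((u t).2 - s * (u t).1)
       - (al + be * (g t).1.1) ^+ 2 * (u t).1 / 2))) (fun t => (nrm (u t))%:E)) => //.
- by rewrite lexx ler01.
- by apply: abs_cont01Z; exact: abs_cont01_pot.
- have mx := abs_cont01_measurable ax.
  have mc (c : R) : measurable_fun (`[0%R, 1%R]%classic : set R) (fun=> c : R) by exact: measurable_cst.
  have mv : measurable_fun (`[0%R, 1%R]%classic : set R) (fun t => (u t).2 - s * (u t).1).
    by apply: measurable_funB => //; apply: measurable_funM.
  have mt : measurable_fun (`[0%R, 1%R]%classic : set R) (fun t => al + be * (g t).1.1).
    by apply: measurable_funD => //; apply: measurable_funM.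
  apply: measurable_funM => //; apply: measurable_funD.
    by apply: measurable_funD; apply: measurable_funM.
  apply: measurable_funM => //; apply: measurable_funB; first exact: measurable_funM.
  do 2 apply: measurable_funM => //; apply: measurable_funX => //.
- move=> t t01; rewrite lee_fin ler_pdivrMl//.
  have := hL (al + be * (g t).1.1) _ (u t).1 ((u t).2 - s * (u t).1).
  rewrite (_ : s * (u t).1 + ((u t).2 - s * (u t).1) = (u t).2); last by ring.
  rewrite (_ : ((u t).1, (u t).2) = u t); last by case: (u t).
  move=> h; apply: le_trans (h _) _.
    by apply: hr; rewrite -gq; apply: le_trans (range t t01) _.
  rewrite mulrDl mul1r lerD2l -mulrA ler_wpM2l//.
  by rewrite ler_pdivlMl.
- apply: (@filterS _ _ (ae_filter_ringOfSetsType (@lebesgue_measure R))) ae => t + tt => /(_ tt) [dxt dyt dzt].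
  by apply: is_deriveZf; exact: is_derive_pot.
Qed.

End LowerBound.

(** * Upper bound for the distance by an explicit curve *)

Section UpperBound.
Variable R : realType.
Implicit Types (nrm : R * R -> R) (p q : R * R * R).

Lemma is_derive_cube (a b c d t : R) :
  is_derive t 1 (fun r : R => a + b * r + c * r ^+ 2 + d * r ^+ 3) (b + 2 * c * t + 3 * d * t ^+ 2).
Proof.
have i := is_derive_id t (1 : R).
have D := is_deriveDf (is_derive_cst a t 1) (is_deriveDf (is_deriveZf b i)
  (is_deriveDf (is_deriveZf c (is_deriveMf i i)) (is_deriveZf d (is_deriveMf i (is_deriveMf i i))))).
rewrite [X in is_derive _ _ X _](_ : _ = (fun s : R => a + (b * s + (c * (s * s) + d * (s * (s * s)))))); last first.
  by apply/funext => r; ring.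
by apply: (is_derive_eq D); ring.
Qed.

Lemma abs_cont01_cube (a b c d : R) : abs_cont01 (fun r : R => a + b * r + c * r ^+ 2 + d * r ^+ 3).
Proof.
have i : abs_cont01 (@id R).
  by apply: (lipschitz_abs_cont01 (C := 1)) => x y _ xy _; rewrite mul1r ger0_norm// subr_ge0.
have D := abs_cont01D (abs_cont01_cst a) (abs_cont01D (abs_cont01Z b i)
  (abs_cont01D (abs_cont01Z c (abs_cont01M i i)) (abs_cont01Z d (abs_cont01M i (abs_cont01M i i))))).
rewrite (_ : (fun _ => _) = (fun s : R => a + (b * s + (c * (s * s) + d * (s * (s * s))))))//.
by apply/funext => r; ring.
Qed.

Lemma L2_01_abs_cont (f : R -> R) : abs_cont01 f -> L2_01 f.
Proof.
move=> af; split; first exact: abs_cont01_measurable.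
have [M hM] := abs_cont01_bounded af.
apply: (@le_lt_trans _ _ (\int[@lebesgue_measure R]_(t in (`[0%R, 1%R]%classic : set R)) (cst (M ^+ 2)%:E t))%E).
  apply: nonneg_integral_le => t; rewrite ?lee_fin ?sqr_ge0// => tI.
  have t01 : 0 <= t <= 1 by move: tI; rewrite /= in_itv.
  rewrite -real_normK ?num_real// lerXn2r ?nnegrE//; last exact: hM.
  exact: le_trans (normr_ge0 _) (hM t t01).
rewrite integral_cst; last exact: measurable_itv.
by rewrite [X in (_ * X)%E](lebesgue_measure_itv `[0, 1]%R)/= lte_fin ltr01 -EFinB -EFinM ltey.
Qed.

Lemma integral_derive01 (F f : R -> R) :
  (forall t : R, is_derive t (1 : R) F (f t)) -> abs_cont01 f ->
  (\int[@lebesgue_measure R]_(t in (`[0%R, 1%R]%classic : set R)) (f t)%:E = (F 1 - F 0)%:E)%E.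
Proof.
move=> dF af; rewrite EFinB; apply: continuous_FTC2 => //.
- exact: abs_cont01_continuous.
- have cF (t : R) : {for t, continuous F}.
    by apply: differentiable_continuous; apply/derivable1_diffP; have [] := dF t.
  split; first by move=> t _; have [] := dF t.
  + exact: cvg_at_right_filter (cF 0).
  + exact: cvg_at_left_filter (cF 1).
- by move=> t _; rewrite derive1E; have [_ ->] := dF t.
Qed.

(** The competitor moves affinely in x with slope dy/dx = al + be x; the last two hypotheses say
    that it ends at q. On it the calibration matches the quadratic majorant of the norm exactly. *)
Lemma upper_bound nrm (s c0 c1 k r al be : R) p q :
  (forall v, 0 <= nrm v) -> (forall a v, nrm (a *: v) = `|a| * nrm v) ->
  (forall sg, `|sg| <= r -> nrm (1, s + sg) <= c0 + c1 * sg + k * sg ^+ 2 / 2) ->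
  p.1.1 <= q.1.1 ->
  (forall x, p.1.1 <= x <= q.1.1 -> `|al + be * x| <= r) ->
  yco s q - yco s p = al * (q.1.1 - p.1.1) + be * (q.1.1 ^+ 2 - p.1.1 ^+ 2) / 2 ->
  wco s q - wco s p = al * (q.1.1 ^+ 2 - p.1.1 ^+ 2) / 2 + be * (q.1.1 ^+ 3 - p.1.1 ^+ 3) / 3 ->
  (sF_dist nrm p q <= (pot s c0 c1 k al be q - pot s c0 c1 k al be p)%:E)%E.
Proof.
move=> n0 nZ hU pq hr ey ew.
pose h := q.1.1 - p.1.1; have h0 : 0 <= h by rewrite subr_ge0.
set xp := p.1.1 in hr ey ew h h0 pq *; set yp := yco s p; set wp := wco s p.
pose x (t : R) := xp + h * t.
pose y (t : R) := yp + al * (x t - xp) + be * (x t ^+ 2 - xp ^+ 2) / 2.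
pose w (t : R) := wp + al * (x t ^+ 2 - xp ^+ 2) / 2 + be * (x t ^+ 3 - xp ^+ 3) / 3.
pose g (t : R) := (x t, y t + s * x t, w t - x t * y t / 2).
pose u (t : R) := (h, (s + (al + be * x t)) * h).
have dx (t : R) : is_derive t 1 (fun r => (g r).1.1) (u t).1.
  have D := is_derive_cube xp h 0 0 t.
  rewrite [X in is_derive _ _ X _](_ : _ = (fun r : R => xp + h * r + 0 * r ^+ 2 + 0 * r ^+ 3)); last first.
    by apply/funext => r0; rewrite /g /x /=; ring.
  by apply: (is_derive_eq D); rewrite /u/=; ring.
have ax : abs_cont01 (fun r => (g r).1.1).
  rewrite (_ : (fun _ => _) = (fun r : R => xp + h * r + 0 * r ^+ 2 + 0 * r ^+ 3)).
    exact: abs_cont01_cube.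
  by apply/funext => r0; rewrite /g /x /=; ring.
pose y0 := yp + s * xp; pose y1 := h * (s + al + be * xp); pose y2 := be * h ^+ 2 / 2.
have yE : (fun r => (g r).1.2) = (fun r : R => y0 + y1 * r + y2 * r ^+ 2 + 0 * r ^+ 3).
  by apply/funext => r0; rewrite /g /y /x /y0 /y1 /y2 /=; field.
pose z0 := wp - xp * yp / 2; pose z1 := h * ((al + be * xp) * xp) - (h * yp + xp * h * (al + be * xp)) / 2.
pose z2 := (h ^+ 2 * al + 2 * be * xp * h ^+ 2) / 2 - (xp * be * h ^+ 2 / 2 + h ^+ 2 * (al + be * xp)) / 2.
pose z3 := be * h ^+ 3 / 3 - h * be * h ^+ 2 / 4.
have zE : (fun r => (g r).2) = (fun r : R => z0 + z1 * r + z2 * r ^+ 2 + z3 * r ^+ 3).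
  by apply/funext => r0; rewrite /g /w /y /x /z0 /z1 /z2 /z3 /=; field.
have dy (t : R) : is_derive t 1 (fun r => (g r).1.2) (u t).2.
  rewrite yE; apply: (is_derive_eq (is_derive_cube _ _ _ _ _)).
  by rewrite /u /x /y1 /y2 /=; field.
have dz (t : R) : is_derive t 1 (fun r => (g r).2) (- (g t).1.2 / 2 * (u t).1 + (g t).1.1 / 2 * (u t).2).
  rewrite zE; apply: (is_derive_eq (is_derive_cube _ _ _ _ _)).
  by rewrite /u /g /y /x /z1 /z2 /z3 /=; field.
have g0 : g 0 = p.
  rewrite /g /w /y /x mulr0 addr0 !subrr !mulr0 !mul0r !addr0 /wp /wco /yp /yco -/xp.
  by rewrite subrK addrK /xp; case: (p) => [[]].
have x1 : x 1 = q.1.1 by rewrite /x /h; ring.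
have g1 : g 1 = q.
  have y1E : y 1 = yco s q by rewrite /y x1 -addrA -ey addrC subrK.
  have w1E : w 1 = wco s q by rewrite /w x1 -addrA -ew addrC subrK.
  by rewrite /g w1E y1E x1 /wco addrK /yco subrK; case: (q) => [[]].
have adm : admissible g u.
  split.
  - by split => //; rewrite ?yE ?zE; exact: abs_cont01_cube.
  - exact: L2_01_abs_cont (abs_cont01_cst h).
  - apply: L2_01_abs_cont.
    rewrite (_ : (fun _ => _) = (fun r : R => y1 + h ^+ 2 * be * r + 0 * r ^+ 2 + 0 * r ^+ 3)).
      exact: abs_cont01_cube.
    by apply/funext => r0; rewrite /u /x /y1 /=; ring.
  - by apply: aeW => t _; split.
apply: (@le_trans _ _ (curve_length nrm u)).
  by apply: ereal_inf_lbound; exists g, u.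
(* Here y' = tau x', so tau y' - tau^2 x' / 2 = tau^2 x' / 2 and the derivative of [pot] is x' times
   the quadratic polynomial at tau. *)
pose f (t : R) := c0 * h + c1 * ((al + be * x t) * h) + k * ((al + be * x t) ^+ 2 * h / 2).
have df (t : R) : is_derive t 1 (fun t => pot s c0 c1 k al be (g t)) (f t).
  apply: (is_derive_eq (is_derive_pot _ _ _ _ _ _ (dx t) (dy t) (dz t))).
  by rewrite /f /u /=; field.
rewrite -g0 -{1}g1 -(integral_derive01 df); last first.
  pose f0 := h * (c0 + c1 * (al + be * xp) + k * (al + be * xp) ^+ 2 / 2).
  pose f1 := h * (c1 * be * h + k * (al + be * xp) * be * h).
  pose f2 := h * k * be ^+ 2 * h ^+ 2 / 2.
  rewrite (_ : f = (fun r : R => f0 + f1 * r + f2 * r ^+ 2 + 0 * r ^+ 3)).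
    exact: abs_cont01_cube.
  by apply/funext => t; rewrite /f /f0 /f1 /f2 /x; field.
apply: nonneg_integral_le => t; rewrite /= ?lee_fin// in_itv/= => /andP[t0 t1].
rewrite (_ : u t = h *: (1, s + (al + be * x t))); last first.
  by rewrite /u; congr pair; rewrite /GRing.scale/= ?mulr1// mulrC.
rewrite nZ ger0_norm// (_ : f t = h * (c0 + c1 * (al + be * x t) + k * (al + be * x t) ^+ 2 / 2)); last first.
  by rewrite /f; field.
apply: ler_wpM2l => //; apply: hU; apply: hr.
have : 0 <= h * t by exact: mulr_ge0.
have : h * t <= h by rewrite ler_piMr.
by rewrite /x /h => *; apply/andP; split; lra.
Qed.

End UpperBound.

(** * Almost quadratic behaviour on an extremal chord; extension to all velocities *)

Section NearQuadratic.
Variable R : realType.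

(* The infimum k of the strong convexity ratios is almost attained on some chord
   [a, b]; strong convexity with constant k then forces near equality on all of it. *)
Lemma near_quadratic (phi : R -> R) (lo hi k1 : R) : lo < hi -> 0 < k1 ->
  (forall a b t, lo <= a <= hi -> lo <= b <= hi -> 0 <= t <= 1 ->
    phi (t * a + (1 - t) * b) <=
      t * phi a + (1 - t) * phi b - k1 / 2 * (t * (1 - t)) * (a - b) ^+ 2) ->
  forall eta, 0 < eta -> exists k a b, [/\ k1 <= k, lo <= a, a < b, b <= hi &
    forall t, 0 <= t <= 1 ->
      t * phi a + (1 - t) * phi b - k / 2 * (t * (1 - t) + eta) * (b - a) ^+ 2
        <= phi (t * a + (1 - t) * b) <=
      t * phi a + (1 - t) * phi b - k / 2 * (t * (1 - t)) * (b - a) ^+ 2].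
Proof.
move=> lohi k10 hphi eta eta0.
(* T is the convexity defect of phi on a chord, D that of x^2 / 2; k will be the infimum of T /
   D. *)
have [T TE] : exists T, forall a b t, T a b t = t * phi a + (1 - t) * phi b - phi (t * a + (1 - t) * b).
  by eexists.
have [D DE] : exists D, forall a b t : R, D a b t = t * (1 - t) * (b - a) ^+ 2 / 2 by eexists.
pose K : set R := [set x | exists a b t, [/\ lo <= a, a < b, b <= hi, 0 < t < 1 & x = T a b t / D a b t]].
have D0 a b t : a < b -> 0 < t < 1 -> 0 < D a b t.
  move=> ab /andP[t0 t1]; rewrite !DE divr_gt0// mulr_gt0 ?exprn_gt0 ?subr_gt0//.
  by rewrite mulr_gt0 ?subr_gt0.
have infK : has_inf K.
  split; first by exists (T lo hi (1/2) / D lo hi (1/2)), lo, hi, (1/2); split => //; lra.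
  exists k1 => x [a [b [t [la ab bh t01 ->]]]].
  rewrite ler_pdivlMr ?D0//.
  have := hphi a b t; rewrite !TE !DE.
  have /andP[t0 t1] := t01.
  by move=> /(_ ltac:(lra) ltac:(lra) ltac:(lra)); rewrite -(sqrrN (a - b)) opprB; lra.
pose k := inf K.
have k1k : k1 <= k.
  apply: lb_le_inf infK.1 _ => x [a [b [t [la ab bh t01 ->]]]].
  rewrite ler_pdivlMr ?D0//.
  have := hphi a b t; rewrite !TE !DE.
  have /andP[t0 t1] := t01.
  by move=> /(_ ltac:(lra) ltac:(lra) ltac:(lra)); rewrite -(sqrrN (a - b)) opprB; lra.
have k0 : 0 < k by lra.
have kT a b t : lo <= a -> a < b -> b <= hi -> 0 <= t <= 1 -> k * D a b t <= T a b t.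
  move=> la ab bh /andP[]; rewrite le_eqVlt => /predU1P[<-|t0].
    by rewrite !DE !TE !mul0r subr0 !mul1r !add0r subrr mulr0.
  rewrite le_eqVlt => /predU1P[->|t1].
    by rewrite !DE !TE subrr !(mul0r, mulr0, mul1r, addr0) subrr.
  have t01 : 0 < t < 1 by rewrite t0.
  rewrite -ler_pdivlMr ?D0//; apply: ge_inf infK.2 _ _.
  by exists a, b, t.
(* A chord almost optimal at one parameter t0; the rest propagates near optimality to every t. *)
have [_ [a [b [t0 [la ab bh t01 ->]]]]] : exists2 x, K x & x < k + k * eta.
  by apply: inf_adherent => //; rewrite mulr_gt0.
rewrite ltr_pdivrMr ?D0// => hT.
clear infK hphi; clearbody k; clear K.
exists k, a, b; split => // t tt.
have ba0 : 0 < (b - a) ^+ 2 by rewrite exprn_gt0// subr_gt0.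
have [t00 t11] := andP t01; have [t_0 t_1] := andP tt.
apply/andP; split; last by have := kT a b t la ab bh tt; rewrite !TE !DE; lra.
suff TT : T a b t <= k / 2 * (t * (1 - t) + eta) * (b - a) ^+ 2 by move: TT; rewrite !TE; lra.
have aux (e1 e2 e3 d1 d2 kk : R) : e1 + e2 = e3 -> k * d2 <= e2 ->
    e3 < (k + kk) * d1 -> e1 <= k * (d1 - d2) + kk * d1 by move: (k) => k'; lra.
have C0 : 0 <= k / 2 * eta * (b - a) ^+ 2.
  apply: mulr_ge0 (ltW ba0); apply: mulr_ge0 (ltW eta0); lra.
(* t0 a + (1 - t0) b is a barycenter, with weight l, of u = t a + (1 - t) b and of
   the endpoint lying on the other side; T is additive along such a subdivision. *)
have [tt0|t0t] := leP t t0.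
- pose l := (t0 - t) / (1 - t).
  have t1 : 0 < 1 - t by clear -tt0 t11; lra.
  have l0 : 0 <= l by apply: divr_ge0; clear -t_0 t_1 t00 t11 ab tt0; lra.
  have l1 : 1 - l = (1 - t0) / (1 - t) by rewrite /l; field; clear -t_0 t_1 t00 t11 ab tt0; lra.
  have l1' : 0 < 1 - l by rewrite l1 divr_gt0//; clear -t_0 t_1 t00 t11 ab tt0; lra.
  pose u := t * a + (1 - t) * b.
  have ua : a <= u by rewrite /u -subr_ge0 (_ : _ - a = (1 - t) * (b - a)); [rewrite mulr_ge0//; clear -t_0 t_1 t00 t11 ab tt0; lra|ring].
  have ub : u <= b by rewrite /u -subr_ge0 (_ : b - _ = t * (b - a)); [rewrite mulr_ge0//; clear -t_0 t_1 t00 t11 ab tt0; lra|ring].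
  have E : (1 - l) * T a b t + T a u l = T a b t0.
    rewrite !TE (_ : l * a + (1 - l) * u = t0 * a + (1 - t0) * b); last first.
      by rewrite l1 /l /u; field; clear -t_0 t_1 t00 t11 ab tt0; lra.
    by rewrite -/u l1 /l; field; clear -t_0 t_1 t00 t11 ab tt0; lra.
  have N : k * D a u l <= T a u l.
    move: ua; rewrite le_eqVlt => /predU1P[ua|ua].
      by rewrite !DE !TE -ua subrr expr0n/= mulr0 mul0r mulr0 (_ : l * a + (1 - l) * a = a); [clear; lra|ring].
    by apply: kT => //; clear -la bh ua ub l0 l1' ; lra.
  have Dlt : D a b t0 - D a u l = (1 - l) * D a b t.
    by rewrite !DE l1 /l /u; field; clear -t_0 t_1 t00 t11 ab tt0; lra.
  have : (1 - l) * T a b t <= (1 - l) * (k * D a b t) + k * eta * D a b t0.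
    by rewrite (mulrCA (1 - l) k) -Dlt; exact: aux E N hT.
  (* The excess gets divided by the weight 1 - l, which may be small; the bound t0 (1 - t0) <= 1 - l
     compensates this uniformly in t. *)
  have : k * eta * D a b t0 <= (1 - l) * (k / 2 * eta * (b - a) ^+ 2).
    rewrite !DE (_ : _ * _ = (t0 * (1 - t0)) * (k / 2 * eta * (b - a) ^+ 2)); last by field.
    apply: ler_wpM2r => //.
    rewrite l1 ler_pdivlMr// (_ : t0 * (1 - t0) * (1 - t) = (1 - t0) * (t0 * (1 - t))); last by ring.
    have tt1 : t0 * (1 - t) <= 1 by apply: mulr_ile1; clear -t_0 t_1 t00 t11 ab tt0; lra.
    by rewrite ler_piMr// subr_ge0 ltW.
  move=> h1 h2; rewrite -(ler_pM2l l1'); apply: le_trans h2 _.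
  rewrite (_ : k / 2 * (t * (1 - t) + eta) * (b - a) ^+ 2 = k * D a b t + k / 2 * eta * (b - a) ^+ 2); last by rewrite !DE; field.
  by rewrite mulrDr; lra.
- pose l := (t - t0) / t.
  have t1 : 0 < t by clear -t_0 t_1 t00 t11 ab t0t; lra.
  have l0 : 0 <= l by apply: divr_ge0; clear -t_0 t_1 t00 t11 ab t0t; lra.
  have l1 : 1 - l = t0 / t by rewrite /l; field; clear -t_0 t_1 t00 t11 ab t0t; lra.
  have l1' : 0 < 1 - l by rewrite l1 divr_gt0//; clear -t_0 t_1 t00 t11 ab t0t; lra.
  pose u := t * a + (1 - t) * b.
  have ua : a <= u by rewrite /u -subr_ge0 (_ : _ - a = (1 - t) * (b - a)); [rewrite mulr_ge0//; clear -t_0 t_1 t00 t11 ab t0t; lra|ring].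
  have ub : u <= b by rewrite /u -subr_ge0 (_ : b - _ = t * (b - a)); [rewrite mulr_ge0//; clear -t_0 t_1 t00 t11 ab t0t; lra|ring].
  have E : (1 - l) * T a b t + T u b (1 - l) = T a b t0.
    rewrite !TE (_ : (1 - l) * u + (1 - (1 - l)) * b = t0 * a + (1 - t0) * b); last first.
      by rewrite l1 /u; field; clear -t_0 t_1 t00 t11 ab t0t; lra.
    by rewrite -/u l1; field; clear -t_0 t_1 t00 t11 ab t0t; lra.
  have N : k * D u b (1 - l) <= T u b (1 - l).
    move: ub; rewrite le_eqVlt => /predU1P[ub|ub].
      by rewrite !DE !TE -ub subrr expr0n/= mulr0 mul0r mulr0 (_ : (1 - l) * u + (1 - (1 - l)) * u = u); [clear; lra|ring].
    by apply: kT => //; clear -la bh ua ub l0 l1' ; lra.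
  have Dlt : D a b t0 - D u b (1 - l) = (1 - l) * D a b t.
    by rewrite !DE l1 /u; field; clear -t_0 t_1 t00 t11 ab t0t; lra.
  have : (1 - l) * T a b t <= (1 - l) * (k * D a b t) + k * eta * D a b t0.
    by rewrite (mulrCA (1 - l) k) -Dlt; exact: aux E N hT.
  have : k * eta * D a b t0 <= (1 - l) * (k / 2 * eta * (b - a) ^+ 2).
    rewrite !DE (_ : _ * _ = (t0 * (1 - t0)) * (k / 2 * eta * (b - a) ^+ 2)); last by field.
    apply: ler_wpM2r => //.
    have tt1 : (1 - t0) * t <= 1 by apply: mulr_ile1; clear -t_0 t_1 t00 t11 ab t0t; lra.
    by rewrite l1 ler_pdivlMr// -mulrA ler_piMr// ltW.
  move=> h1 h2; rewrite -(ler_pM2l l1'); apply: le_trans h2 _.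
  rewrite (_ : k / 2 * (t * (1 - t) + eta) * (b - a) ^+ 2 = k * D a b t + k / 2 * eta * (b - a) ^+ 2); last by rewrite !DE; field.
  by rewrite mulrDr; lra.
Qed.

(** Turns an estimate on the window into one for all velocities. The convex function P 1 is
    nonpositive at tau and nonnegative at both ends of the window, hence nonnegative beyond them;
    subadditivity against (1, tau) then treats vertical and backward velocities. *)
Lemma sublinear_ge (P : R -> R -> R) (e r tau : R) :
  (forall a x y, 0 <= a -> P (a * x) (a * y) = a * P x y) ->
  (forall x y x' y', P (x + x') (y + y') <= P x y + P x' y') ->
  0 <= e -> `|tau| < r -> P 1 tau <= 0 -> 0 <= P 1 r -> 0 <= P 1 (- r) ->
  (forall sg, `|sg| <= r -> - e <= P 1 sg) ->
  forall x y, - (e * `|x|) <= P x y.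
Proof.
move=> PZ PD e0; rewrite ltr_norml => /andP[tr1 tr2] Pt Pr PNr Psg.
(* P (0, y) is at least P (1, tau + y) - P (1, tau); choose y so that tau + y is an end of the
   window, then rescale. *)
have Py y : 0 <= P 0 y.
  have [y0|y0] := leP 0 y.
    have h : 0 <= P 0 (r - tau).
      by have := PD 1 tau 0 (r - tau); rewrite addr0 (addrC tau) subrK; lra.
    have -> : P 0 y = y / (r - tau) * P 0 (r - tau).
      by rewrite -PZ ?divr_ge0 ?mulr0 ?divfK//; lra.
    by rewrite mulr_ge0// divr_ge0//; lra.
  have h : 0 <= P 0 (- r - tau).
    by have := PD 1 tau 0 (- r - tau); rewrite addr0 (addrC tau) subrK; lra.
  have -> : P 0 y = y / (- r - tau) * P 0 (- r - tau).
    rewrite -PZ ?mulr0 ?divfK//; first by lra.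
    by rewrite mulr_le0// ?invr_le0; lra.
  by rewrite mulr_ge0// mulr_le0// ?invr_le0; lra.
have conv l u v : 0 <= l <= 1 -> P 1 (l * u + (1 - l) * v) <= l * P 1 u + (1 - l) * P 1 v.
  move=> /andP[l0 l1]; rewrite -PZ// -PZ; last by lra.
  apply: le_trans (PD _ _ _ _); rewrite !mulr1 (addrC l) subrK//.
have P1 sg : - e <= P 1 sg.
  have [|] := leP `|sg| r; first exact: Psg.
  suff pos u l : 0 <= P 1 u -> 0 <= l < 1 -> u = l * tau + (1 - l) * sg -> - e <= P 1 sg.
    rewrite ltNge ler_norml negb_and -!ltNge => /orP[sr|sr].
    - apply: (pos (- r) ((- r - sg) / (tau - sg))) => //; last by field; lra.
      by rewrite divr_ge0 ?ltr_pdivrMr; lra.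
    - apply: (pos r ((sg - r) / (sg - tau))) => //; last by field; lra.
      by rewrite divr_ge0 ?ltr_pdivrMr; lra.
  move=> Pu /andP[l0 l1] uE; have l01 : 0 <= l <= 1 by rewrite l0 ltW.
  have := conv l tau sg l01; rewrite -uE => h.
  have : l * P 1 tau <= 0 by rewrite mulr_ge0_le0.
  move=> h'; have : 0 <= (1 - l) * P 1 sg by lra.
  by rewrite pmulr_rge0; lra.
have neg y : 0 <= P (-1) y.
  by have := PD (-1) y 1 tau; rewrite addNr; have := Py (y + tau); lra.
move=> x y; have [x0|x0|->] := ltrgt0P x.
- have -> : P x y = x * P 1 (y / x) by rewrite -PZ ?(ltW x0)// mulr1 mulrC divfK// gt_eqF.
  by rewrite mulrC -mulrN; apply: ler_wpM2l (P1 _); exact: ltW.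
- have -> : P x y = - x * P (-1) (y / - x).
    by rewrite -PZ ?oppr_ge0 ?(ltW x0)// mulrN1 opprK mulrC divfK// oppr_eq0 lt_eqF.
  have := mulr_ge0 (_ : 0 <= - x) (neg (y / - x)); rewrite oppr_ge0 => /(_ (ltW x0)).
  by have := mulr_ge0 e0 (_ : 0 <= - x); rewrite oppr_ge0 => /(_ (ltW x0)); lra.
- by rewrite mulr0 oppr0.
Qed.
End NearQuadratic.

(** * The norm on the line x = 1 *)

Section Norm.
Variables (R : realType) (nrm : R * R -> R).
Hypothesis Hn : is_norm nrm.
Local Notation phi := (fun s : R => nrm (1, s)).
Local Notation n := (nrm (0, 1)).

Lemma norm0E v : nrm v = 0 -> v = 0. Proof. by case: Hn => h _ _; exact: h. Qed.
Lemma normZ (a : R) v : nrm (a *: v) = `|a| * nrm v. Proof. by case: Hn => _ h _; exact: h. Qed.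
Lemma normD v w : nrm (v + w) <= nrm v + nrm w. Proof. by case: Hn => _ _ h; exact: h. Qed.
Lemma norm_ge0 v : 0 <= nrm v.
Proof.
have := normD v (- v); rewrite subrr -(scaleN1r v) normZ normrN1 mul1r.
by have := normZ 0 0; rewrite scale0r normr0 mul0r => ->; lra.
Qed.

Lemma norm_pair0 y : nrm (0, y) = `|y| * n.
Proof.
rewrite -normZ; congr nrm; congr pair; rewrite /GRing.scale/= ?mulr0 ?mulr1//.
Qed.

Lemma norm_pair x y : x != 0 -> nrm (x, y) = `|x| * nrm (1, y / x).
Proof.
move=> x0; rewrite -normZ; congr nrm; congr pair; rewrite /GRing.scale/= ?mulr1//.
by rewrite mulrC divfK.
Qed.

Lemma n_gt0 : 0 < n.
Proof.
rewrite lt_neqAle norm_ge0 andbT eq_sym; apply/eqP => /norm0E [] /eqP.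
by rewrite oner_eq0.
Qed.

Lemma phi_lip s t : `|phi s - phi t| <= n * `|s - t|.
Proof.
have K a b : phi a - phi b <= n * `|a - b|.
  have := normD (1, b) (0, a - b); rewrite norm_pair0 [_ * n]mulrC.
  rewrite (_ : (1, b) + (0, a - b) = (1, a)); last by congr pair => /=; ring.
  by lra.
rewrite ler_norml; have := K s t; have := K t s; rewrite (distrC t) => *; apply/andP; split; lra.
Qed.

Lemma phi_convex a b t : 0 <= t <= 1 ->
  phi (t * a + (1 - t) * b) <= t * phi a + (1 - t) * phi b.
Proof.
move=> /andP[t0 t1].
have := normD (t *: (1, a)) ((1 - t) *: (1, b)).
rewrite !normZ !ger0_norm ?subr_ge0//.
rewrite (_ : _ *: _ + _ = (1, t * a + (1 - t) * b))//.
by apply: injective_projections; rewrite /= /GRing.scale/=; ring.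
Qed.

(** By the triangle inequality phi t >= n |t| - phi 0, which exceeds phi 0 once |t| > 2 phi 0 / n; a
    minimum on a compact interval is therefore global. *)
Lemma phi_min : exists s, 0 < phi s /\ forall t, phi s <= phi t.
Proof.
have n0 := n_gt0.
have p00 : 0 <= phi 0 by exact: norm_ge0.
pose S := 2 * phi 0 / n.
have S0 : 0 <= S by rewrite divr_ge0 ?mulr_ge0// ltW.
have cphi : continuous phi.
  move=> x; apply/cvgrPdist_lt => e e0.
  apply/nbhs_ballP; exists (e / n); first by rewrite /= divr_gt0.
  move=> y; rewrite /ball/= ltr_pdivlMr// mulrC; apply: le_lt_trans; exact: phi_lip.
have [s _ hs] := @EVT_min R phi (- S) S ltac:(lra) (@continuous_subspaceT _ _ _ _ cphi).
exists s; split.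
  rewrite lt_neqAle norm_ge0 andbT eq_sym; apply/eqP => /norm0E [] /eqP.
  by rewrite oner_eq0.
move=> t; have [tS|St] := leP `|t| S; first by apply: hs; rewrite in_itv/= -ler_norml.
apply: (@le_trans _ _ (phi 0)); first by apply: hs; rewrite in_itv/=; lra.
have := normD (1, t) (-1, 0).
rewrite (_ : (1, t) + (-1, 0) = (0, t)); last by congr pair => /=; rewrite ?subrr ?addr0.
rewrite norm_pair0 (_ : nrm (-1, 0) = phi 0); last first.
  have <- : nrm ((-1) *: (1, 0)) = phi 0 by rewrite normZ normrN1 mul1r.
  by congr nrm; apply: injective_projections; rewrite /= /GRing.scale/= ?mulr0 ?mulr1.
by move: St; rewrite /S ltr_pdivrMr//; lra.
Qed.

Hypothesis HC : norm_C1 nrm.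
Hypothesis HS : norm_strongly_convex nrm.

(** Differentiability enters here: the derivative of phi vanishes at its minimum. *)
Lemma phi_flat sm : (forall t, phi sm <= phi t) -> forall th, 0 < th ->
  exists2 h, 0 < h & forall t, `|t - sm| < h -> phi t - phi sm <= th * `|t - sm|.
Proof.
move=> hmin th th0.
have v0 : ((1, sm) : R * R) != 0 by apply/eqP => -[] /eqP; rewrite oner_eq0.
have [dn _] := HC v0.
have dphi : exists d, is_derive sm (1 : R) phi d.
  have dv : derivable nrm (1, sm) (0, 1) by exact: diff_derivable.
  exists ('D_(0, 1) nrm (1, sm)).
  have E : (fun h : R => h^-1 *: (phi (h *: (1 : R) + sm) - phi sm)) =
      (fun h : R => h^-1 *: (nrm (h *: ((0, 1) : R * R) + (1, sm)) - nrm (1, sm))).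
    apply/funext => h; congr (_ *: (nrm _ - _)).
    by apply: injective_projections; rewrite /= /GRing.scale/=; ring.
  split.
  - by move: dv; rewrite /derivable -E.
  - by rewrite /derive -E.
case: dphi => d dphi.
suff d0 : d = 0.
  have [r r0 hr] := is_derive_near dphi th0.
  exists r => // t /hr; rewrite d0 mul0r subr0; exact: le_trans (ler_norm _).
apply/eqP; apply/negPn/negP => d0.
have nd : 0 < `|d| / 2 by rewrite divr_gt0// normr_gt0.
have [r r0 hr] := is_derive_near dphi nd.
(* A step against the sign of a nonzero derivative would go below the minimum. *)
pose t := sm - Num.sg d * (r / 2).
have ts : t - sm = - (Num.sg d * (r / 2)) by rewrite /t; ring.
have tn : `|t - sm| = r / 2 by rewrite ts normrN normrM normr_sg d0 mul1r gtr0_norm// divr_gt0.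
have := hr t; rewrite tn => /(_ ltac:(lra)); rewrite ler_norml => /andP[_].
have -> : d * (t - sm) = - (`|d| * (r / 2)).
  by rewrite ts mulrN mulrA [d * _]mulrC -normrEsg.
have := hmin t; have : 0 < `|d| * r by rewrite mulr_gt0 ?normr_gt0.
lra.
Qed.

End Norm.

(** * Strong convexity along the line, and the choice of the window *)

Section Window.
Variables (R : realType) (nrm : R * R -> R).
Hypotheses (Hn : is_norm nrm) (HC : norm_C1 nrm) (HS : norm_strongly_convex nrm).
Local Notation phi := (fun s : R => nrm (1, s)).
Local Notation n := (nrm (0, 1)).

(** Strong convexity concerns the square of the norm. For values A, B at the ends and E their
    weighted mean, t A^2 + (1 - t) B^2 = E^2 + t (1 - t) (A - B)^2, and the last term could consume
    the whole gain. Near the minimum the slope of phi is at most 2 th, so this term takes at most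
    half of it. Dividing E^2 - m^2 by E + m <= 4 cx returns to the norm itself. *)
Lemma phi_strong sm hm : 0 < hm -> 0 < phi sm -> (forall t, phi sm <= phi t) ->
  exists h k1, [/\ 0 < h, h <= hm, 0 < k1 &
    forall a b t, sm - h <= a <= sm + h -> sm - h <= b <= sm + h -> 0 <= t <= 1 ->
      phi (t * a + (1 - t) * b) <=
        t * phi a + (1 - t) * phi b - k1 / 2 * (t * (1 - t)) * (a - b) ^+ 2].
Proof.
move=> hm0 cx0 hmin; have n0 := n_gt0 Hn.
have [al [al0 hS]] := HS.
pose cx := phi sm.
pose th := Num.min 1 (al * n ^+ 2 / 8).
have th0 : 0 < th by rewrite lt_min ltr01 divr_gt0// mulr_gt0// exprn_gt0.
have th2 : 8 * th ^+ 2 <= al * n ^+ 2.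
  have th1 : th <= 1 by rewrite ge_min lexx.
  have : th <= al * n ^+ 2 / 8 by rewrite ge_min lexx orbT.
  by have := ler_piMl (ltW th0) th1; rewrite -expr2; lra.
have [h0 h00 flat] := phi_flat HC hmin th0.
(* The bound h0 / 3 keeps points at distance 2 h inside the flat zone; cx / n keeps phi below 2
   cx. *)
pose h := Num.min hm (Num.min (h0 / 3) (cx / n)).
have h_gt0 : 0 < h by rewrite !lt_min hm0 !divr_gt0.
have hh0 : h <= h0 / 3 by rewrite /h !ge_min lexx !orbT.
have hcx : n * h <= cx by rewrite mulrC -ler_pdivlMr// /h !ge_min lexx !orbT.
exists h, (al * n ^+ 2 / (4 * cx)); split => //; first by rewrite ge_min lexx.
  by rewrite divr_gt0 ?mulr_gt0// exprn_gt0.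
have bnd a : sm - h <= a <= sm + h -> phi a <= 2 * cx.
  move=> /andP[a1 a2]; have := phi_lip Hn a sm; rewrite ler_norml => /andP[_].
  have : `|a - sm| <= h by rewrite ler_norml; apply/andP; split; lra.
  by rewrite -(ler_pM2l n0); rewrite -/cx; lra.
have slope a b e : sm - h <= a <= sm + h -> `|e| = 1 -> 0 <= e * (b - a) -> sm - h <= b <= sm + h ->
    phi b - phi a <= 2 * th * (e * (b - a)).
  move=> /andP[a1 a2] e1 ab /andP[b1 b2].
  have [|ab0] := eqVneq (e * (b - a)) 0.
    move/eqP; rewrite mulf_eq0 -normr_eq0 e1 oner_eq0/= subr_eq0 => /eqP ->.
    by rewrite !subrr !mulr0.
  have eE : e = 1 \/ e = -1.
    by case: (ger0P e) e1 => _ e1; [left|right]; lra.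
  (* By convexity the slope from a to b is at most that from a to c, where c is at distance at least
     h from a and phi c exceeds the minimum by at most 2 th h. *)
  pose c := sm + e * (2 * h).
  have ca : h <= e * (c - a) by rewrite /c; case: eE => ->; lra.
  have cb : e * (b - a) <= e * (c - a) by rewrite /c; case: eE => ->; lra.
  pose t := 1 - (e * (b - a)) / (e * (c - a)).
  have t01 : 0 <= t <= 1.
    rewrite /t; apply/andP; split; last by rewrite gerBl divr_ge0//; lra.
    by rewrite subr_ge0 ler_pdivrMr; lra.
  have := phi_convex Hn a c t01.
  have e0 : e != 0 by case: eE => ->; rewrite ?oppr_eq0 oner_eq0.
  have ca0 : c - a != 0.
    by apply/eqP => ca0; move: ca; rewrite ca0 mulr0; lra.
  have -> : t * a + (1 - t) * c = b by rewrite /t; field; rewrite ca0 e0.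
  have cflat : phi c - phi sm <= th * (2 * h).
    have E : `|c - sm| = 2 * h.
      by rewrite /c addrAC subrr add0r normrM e1 mul1r gtr0_norm// mulr_gt0.
    by rewrite -E; apply: flat; rewrite E; lra.
  have ha := hmin a.
  set q := (e * (b - a)) / (e * (c - a)).
  have q0 : 0 <= q by rewrite divr_ge0//; lra.
  have tq : t = 1 - q by [].
  have qh : q * h <= e * (b - a).
    by rewrite /q mulrAC ler_pdivrMr ?ler_wpM2l//; lra.
  have Q : q * (phi c - phi a) <= q * (th * (2 * h)) by apply: ler_wpM2l => //; lra.
  have Q2 : th * (q * h) <= th * (e * (b - a)) by rewrite ler_pM2l.
  rewrite tq; lra.
have slope2 a b : sm - h <= a <= sm + h -> sm - h <= b <= sm + h ->
    (phi a - phi b) ^+ 2 <= 4 * th ^+ 2 * (a - b) ^+ 2.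
  move=> ha hb.
  have S x y : sm - h <= x <= sm + h -> sm - h <= y <= sm + h -> phi y - phi x <= 2 * th * `|y - x|.
    move=> hx hy; case: (ger0P (y - x)) => xy.
    - by have := slope x y 1 hx (normr1 _) (ltac:(lra)) hy; rewrite mul1r.
    - by have := slope x y (-1) hx (normrN1 _) (ltac:(lra)) hy; rewrite mulN1r.
  have -> : 4 * th ^+ 2 * (a - b) ^+ 2 = (2 * th * `|a - b|) ^+ 2.
    by rewrite exprMn real_normK ?num_real//; ring.
  rewrite -[leLHS]real_normK ?num_real//; apply: lerXn2r; rewrite ?nnegrE//.
    by rewrite !mulr_ge0// ltW.
  by rewrite ler_norml; have := S a b ha hb; have := S b a hb ha; rewrite (distrC b) => *; apply/andP; split; lra.
move=> a b t ha hb t01.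
have [t0 t1] := andP t01.
have conv := phi_convex Hn a b t01.
have := hS (1, a) (1, b) t t01.
rewrite (_ : t *: (1, a) + (1 - t) *: (1, b) = (1, t * a + (1 - t) * b)); last first.
  by apply: injective_projections; rewrite /= /GRing.scale/=; ring.
rewrite (_ : (1, a) - (1, b) = (0, a - b)); last first.
  by apply: injective_projections; rewrite /= ?subrr.
rewrite (norm_pair0 Hn) exprMn real_normK ?num_real//.
have m0 := norm_ge0 Hn (1, t * a + (1 - t) * b).
move: conv m0 (slope2 a b ha hb) (bnd a ha) (bnd b hb) (norm_ge0 Hn (1, a)) (norm_ge0 Hn (1, b)).
move: (nrm (1, t * a + (1 - t) * b)) (nrm (1, a)) (nrm (1, b)) => m A B /=.
move=> conv m0 AB A2 B2 A0 B0 sc.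
set E := t * A + (1 - t) * B in conv *.
have tt : 0 <= t * (1 - t) by rewrite mulr_ge0// subr_ge0.
have EE : m ^+ 2 <= E ^+ 2 - (al * n ^+ 2 / 2) * (t * (1 - t)) * (a - b) ^+ 2.
  have -> : E ^+ 2 = t * A ^+ 2 + (1 - t) * B ^+ 2 - t * (1 - t) * (A - B) ^+ 2 by rewrite /E; ring.
  have : t * (1 - t) * (A - B) ^+ 2 <= t * (1 - t) * (al * n ^+ 2 / 2 * (a - b) ^+ 2).
    apply: ler_wpM2l => //; apply: le_trans AB _; apply: ler_wpM2r; first exact: sqr_ge0.
    lra.
  by lra.
have E2 : E <= 2 * cx.
  have : t * A <= t * (2 * cx) by apply: ler_wpM2l.
  have : (1 - t) * B <= (1 - t) * (2 * cx) by apply: ler_wpM2l => //; lra.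
  rewrite /E; lra.
set Q := (t * (1 - t)) * (a - b) ^+ 2.
have QQ : al * n ^+ 2 / 2 * Q <= (E - m) * (4 * cx).
  apply: (@le_trans _ _ ((E - m) * (E + m))).
    by rewrite -subr_sqr /Q mulrA; lra.
  by apply: ler_wpM2l; lra.
have -> : al * n ^+ 2 / (4 * cx) / 2 * (t * (1 - t)) * (a - b) ^+ 2 = (al * n ^+ 2 / 2 * Q) / (4 * cx).
  by rewrite /Q; field; rewrite gt_eqF.
rewrite lerBrDr -lerBrDl ler_pdivrMr ?mulr_gt0//.
Qed.

(** The polynomial interpolates phi at the ends of an almost extremal chord. The linear form in the
    last clause is its tangent at tau, made homogeneous; polynomial minus tangent is k (sg - tau)^2
    / 2 >= 0, so only the error of near quadraticity remains. *)
Lemma window : exists cx, [/\ 0 < cx, forall x y, cx * `|x| <= nrm (x, y) &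
  forall eta rm, 0 < eta -> 0 < rm -> exists s c0 c1 k r,
    [/\ [/\ 0 < k, 0 < r, r <= rm, `|c1| <= n & k * r <= 2 * n],
      cx - n * rm <= c0 <= cx + n * rm,
      forall sg, `|sg| <= r -> nrm (1, s + sg) <= c0 + c1 * sg + k * sg ^+ 2 / 2 &
      forall tau, `|tau| <= r / 2 -> forall x y,
        c0 * x + c1 * y + k * (tau * y - tau ^+ 2 * x / 2)
          <= nrm (x, s * x + y) + 2 * k * eta * r ^+ 2 * `|x| ]].
Proof.
have [sm [cx0 hmin]] := phi_min Hn; have n0 := n_gt0 Hn.
pose cx := phi sm; exists cx; split => //.
  move=> x y; have [->|x0] := eqVneq x 0; first by rewrite normr0 mulr0 (norm_ge0 Hn).
  by rewrite (norm_pair Hn)// mulrC ler_wpM2l.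
move=> eta rm eta0 rm0.
have rm2 : 0 < rm / 2 by lra.
have [h [k1 [h0 hrm k10 hst]]] := phi_strong rm2 cx0 hmin.
have [k [a [b [k1k la ab bh hk]]]] := near_quadratic (ltac:(lra) : sm - h < sm + h) k10 hst eta0.
have k0 : 0 < k by lra.
pose s := (a + b) / 2; pose r := (b - a) / 2.
have r0 : 0 < r by rewrite /r; lra.
have rrm : r <= rm by rewrite /r; lra.
pose c1 := (phi b - phi a) / (2 * r).
pose c0 := (phi a + phi b) / 2 - k * r ^+ 2 / 2.
have quad sg : `|sg| <= r ->
  c0 + c1 * sg + k * sg ^+ 2 / 2 - 2 * k * eta * r ^+ 2 <= phi (s + sg) <= c0 + c1 * sg + k * sg ^+ 2 / 2.
  rewrite ler_norml => /andP[s1 s2].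
  have rN0 : r != 0 by rewrite gt_eqF.
  pose t := (r - sg) / (2 * r).
  have t01 : 0 <= t <= 1.
    by rewrite /t divr_ge0/= ?ler_pdivrMr; lra.
  have := hk t t01.
  have ra : a = s - r by rewrite /s /r; lra.
  have rb : b = s + r by rewrite /s /r; lra.
  have -> : t * a + (1 - t) * b = s + sg by rewrite /t ra rb; field.
  have E : t * phi a + (1 - t) * phi b = (phi a + phi b) / 2 + c1 * sg by rewrite /t /c1; field.
  have D : t * (1 - t) * (b - a) ^+ 2 = r ^+ 2 - sg ^+ 2 by rewrite /t ra rb; field.
  have D2 : (b - a) ^+ 2 = 4 * r ^+ 2 by rewrite ra rb; ring.
  have -> : k / 2 * (t * (1 - t) + eta) * (b - a) ^+ 2 = k / 2 * (r ^+ 2 - sg ^+ 2) + 2 * k * eta * r ^+ 2.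
    by rewrite -mulrA mulrDl D D2; field.
  have -> : k / 2 * (t * (1 - t)) * (b - a) ^+ 2 = k / 2 * (r ^+ 2 - sg ^+ 2) by rewrite -mulrA D.
  by rewrite E /c0 => /andP[l1 l2]; apply/andP; split; lra.
(* Interpolation is exact at the ends of the chord: this gives the signs that [sublinear_ge]
   requires there. *)
have ends : phi (s - r) = c0 - c1 * r + k * r ^+ 2 / 2 /\ phi (s + r) = c0 + c1 * r + k * r ^+ 2 / 2.
  have rN0 : r != 0 by rewrite gt_eqF.
  have -> : s - r = a by rewrite /s /r; lra.
  have -> : s + r = b by rewrite /s /r; lra.
  by rewrite /c0 /c1; split; field.
have slope : `|c1| <= n.
  rewrite /c1 normrM normfV (gtr0_norm (_ : 0 < 2 * r)); last lra.
  rewrite ler_pdivrMr; last lra.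
  by apply: le_trans (phi_lip Hn b a) _; rewrite gtr0_norm /r; lra.
(* The two end values add up to 2 c0 + k r^2 >= 2 phi s + k r^2, and each exceeds phi s by at most n
   r. *)
have kr : k * r <= 2 * n.
  have := quad 0; rewrite normr0 mulr0 expr0n/= mulr0 mul0r !addr0 => /(_ (ltW r0)) /andP[_].
  have := phi_lip Hn (s + r) s; have := phi_lip Hn (s - r) s.
  rewrite (_ : s - r - s = - r); last by ring.
  rewrite (_ : s + r - s = r); last by ring.
  rewrite normrN (gtr0_norm r0) !ler_norml ends.1 ends.2 => /andP[_ h1] /andP[_ h2] h3.
  by rewrite -(ler_pM2r r0); lra.
exists s, c0, c1, k, r; split => //.
- have near u : sm - h <= u <= sm + h -> cx <= phi u <= cx + n * (rm / 2).
    move=> /andP[u1 u2]; have := phi_lip Hn u sm; rewrite ler_norml => /andP[_ h1].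
    rewrite hmin/=.
    have : `|u - sm| <= rm / 2 by rewrite ler_norml; apply/andP; split; lra.
    by rewrite -(ler_pM2l n0) -/cx; move: h1; rewrite -/cx; lra.
  have /andP[a1 a2] := near a ltac:(lra); have /andP[b1 b2] := near b ltac:(lra).
  have kr2 : 0 <= k * r ^+ 2 by rewrite mulr_ge0 ?sqr_ge0// ltW.
  have : k * r ^+ 2 <= 2 * n * rm.
    by rewrite expr2 mulrA; apply: ler_pM => //; rewrite ltW// mulr_gt0.
  have := mulr_gt0 n0 rm0.
  by rewrite /c0; lra.
- by move=> sg /quad /andP[].
- move=> tau htau x y.
  pose P x y := nrm (x, s * x + y) - (c0 * x + c1 * y + k * (tau * y - tau ^+ 2 * x / 2)).
  have e0 : 0 <= 2 * k * eta * r ^+ 2.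
    by rewrite mulr_ge0 ?sqr_ge0// mulr_ge0 ?(ltW eta0)// mulr_ge0// ltW.
  suff : - ((2 * k * eta * r ^+ 2) * `|x|) <= P x y by rewrite /P; lra.
  apply: (@sublinear_ge _ P _ r tau) => //.
  + move=> a' x' y' a0; rewrite /P (_ : (a' * x', _) = a' *: (x', s * x' + y')); last first.
      by apply: injective_projections; rewrite /= /GRing.scale/=; ring.
    by rewrite (normZ Hn) ger0_norm//; field.
  + move=> x1 y1 x2 y2; rewrite /P.
    have := normD Hn (x1, s * x1 + y1) (x2, s * x2 + y2).
    rewrite (_ : _ + _ = (x1 + x2, s * (x1 + x2) + (y1 + y2))); last first.
      by apply: injective_projections; rewrite /=; ring.
    by lra.
  + by apply: le_lt_trans htau _; lra.
  + have /quad /andP[_] : `|tau| <= r by apply: le_trans htau _; lra.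
    by rewrite /P mulr1 !mulr1 -expr2; lra.
  + rewrite /P !mulr1 ends.2; have := mulr_ge0 (ltW k0) (sqr_ge0 (r - tau)); lra.
  + rewrite /P !mulr1 ends.1; have := mulr_ge0 (ltW k0) (sqr_ge0 (r + tau)); lra.
  + move=> sg /quad /andP[q1 _].
    rewrite /P !mulr1; have := mulr_ge0 (ltW k0) (sqr_ge0 (sg - tau)); lra.
Qed.

End Window.

(** * The model curve and its midpoint *)

Section Midpoint.
Variable R : realType.

Lemma absM (u v U V : R) : `|u| <= U -> `|v| <= V -> `|u * v| <= U * V.
Proof. by move=> hu hv; rewrite normrM ler_pM. Qed.

(* Y and W describe the curve with slope dy/dx = al + be x from p to q. *)
Lemma interpolation (xp xq yp yq wp wq a : R) : 0 < a ->
  `|xp + 1| <= 1 / 100 -> `|xq - 1| <= 1 / 100 -> `|yp| <= a -> `|yq| <= a ->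
  `|wp + yp / 2| <= a / 12 -> `|wq - yq / 2| <= a / 12 ->
  exists al be : R,
  let Y x := yp + al * (x - xp) + be * (x ^+ 2 - xp ^+ 2) / 2 in
  let W x := wp + al * (x ^+ 2 - xp ^+ 2) / 2 + be * (x ^+ 3 - xp ^+ 3) / 3 in
  [/\ Y xq = yq /\ W xq = wq,
   forall x, `|x| <= 4 -> `|al + be * x| <= 12 * a,
   al ^+ 2 * (xq - xp) + al * be * (xq ^+ 2 - xp ^+ 2) + be ^+ 2 * (xq ^+ 3 - xp ^+ 3) / 3 <= 8 * (a * a),
   forall x, `|x| <= 3 -> `|Y x| <= 60 * a &
   forall x, `|x - (xp + xq) / 2| <= 1 / 100 / 10 -> `|Y x| <= 21 / 50 * a /\ `|W x| <= 5 / 4 * (a / 12)].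
Proof.
move=> a0 hxp hxq hyp hyq hbp hbq.
move: (hxp) (hxq); rewrite !ler_norml => /andP[xp1 xp2] /andP[xq1 xq2].
pose D := xq - xp; pose xc := (xp + xq) / 2; pose i := D^-1.
have D1 : 99 / 50 <= D by rewrite /D; lra.
have D2 : D <= 101 / 50 by rewrite /D; lra.
have D0 : D != 0 by rewrite gt_eqF//; lra.
have Di : D * i = 1 by rewrite /i divff.
have i1 : `|i - 1 / 2| <= 3 / 5 / 100.
  have -> : i - 1 / 2 = (2 - D) / (2 * D) by rewrite /i; field.
  rewrite normrM normfV (gtr0_norm (_ : 0 < 2 * D)); last lra.
  rewrite ler_pdivrMr; last lra.
  by apply: (@le_trans _ _ (1 / 50)); [rewrite ler_norml|]; lra.
have i2 : `|i| <= 51 / 100.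
  by move: i1; rewrite !ler_norml => /andP[? ?]; lra.
have hxc : `|xc| <= 1 / 100 by rewrite /xc ler_norml; lra.
pose bp := wp + yp / 2; pose bq := wq - yq / 2.
pose dy := yq - yp; pose G := wq - wp - xc * dy.
have hdy : `|dy| <= 2 * a by move: hyp hyq; rewrite /dy !ler_norml => /andP[? ?] /andP[? ?]; lra.
have hxd := absM hxc hdy.
have hG : `|G| <= 6 / 5 * a.
  move: hyp hyq hbp hbq hxd; rewrite /G !ler_norml => /andP[? ?] /andP[? ?] /andP[? ?] /andP[? ?] /andP[? ?].
  by apply/andP; split; lra.
(* Centred at xc the two end conditions decouple: al' is the mean slope, and G, the integral of (x -
   xc) dy, equals be D^3 / 12. *)
pose al' := dy * i; pose be := 12 * G * (i * (i * i)).
have hal' : `|al'| <= 51 / 50 * a by apply: le_trans (absM hdy i2) _; lra.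
have hi2 := absM i2 i2.
have hi3 := absM i2 hi2.
have hbe : `|be| <= 2 * a.
  rewrite /be -mulrA normrM ger0_norm//; have := absM hG hi3; clear -a0; lra.
exists (al' - be * xc), be => Y W.
have tau x : al' - be * xc + be * x = al' + be * (x - xc) by ring.
have htau x : `|x| <= 4 -> `|al' - be * xc + be * x| <= 12 * a.
  move=> hx; rewrite tau.
  have hxx : `|x - xc| <= 5 by move: hx hxc; rewrite !ler_norml; clear => /andP[? ?] /andP[? ?]; lra.
  by apply: le_trans (ler_normD _ _) _; have := absM hbe hxx; move: hal'; clear -a0; lra.
have YE x : Y x = (yp + yq) / 2 - 3 / 2 * (i * G) + al' * (x - xc) + be * ((x - xc) * (x - xc)) / 2.
  by rewrite /Y /be /al' /i /G /dy /xc /D; field.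
have WE x : W x = dy * (2 - D) / 8 + (bp + bq) / 2 - xc * ((yp + yq) / 2)
   + xc * ((yp + yq) / 2 - 3 / 2 * (i * G) + al' * (x - xc) + be * ((x - xc) * (x - xc)) / 2)
   + al' * ((x - xc) * (x - xc)) / 2 + be * ((x - xc) * ((x - xc) * (x - xc))) / 3.
  by rewrite /W /be /al' /i /G /dy /xc /D /bp /bq; field.
split => //.
- by split; rewrite /Y /W /be /al' /i /G /dy /xc /D; field.
- have -> : (al' - be * xc) ^+ 2 * (xq - xp) + (al' - be * xc) * be * (xq ^+ 2 - xp ^+ 2)
     + be ^+ 2 * (xq ^+ 3 - xp ^+ 3) / 3 = al' * al' * D + be * be * (D * (D * D)) / 12.
    by rewrite /xc /D; field.
  have hD : `|D| <= 21 / 10 by rewrite ler_norml; clear -D1 D2; lra.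
  have h1 := absM (absM hal' hal') hD.
  have h2 := absM (absM hbe hbe) (absM hD (absM hD hD)).
  have aa : 0 <= a * a by rewrite mulr_ge0// ltW.
  by move: aa h1 h2; rewrite !ler_norml; clear => aa /andP[_ h1] /andP[_ h2]; lra.
- move=> x hx.
  have -> : Y x = yp + (x - xp) * (al' - be * xc + be * ((x + xp) / 2)) by rewrite /Y; field.
  have hm : `|(x + xp) / 2| <= 4 by move: hx; rewrite !ler_norml; clear -xp1 xp2 => /andP[? ?]; lra.
  have hd : `|x - xp| <= 41 / 10 by move: hx; rewrite !ler_norml; clear -xp1 xp2 => /andP[? ?]; lra.
  by apply: le_trans (ler_normD _ _) _; have := absM hd (htau _ hm); move: hyp; clear -a0; lra.
- move=> x; rewrite -/xc => hd.
  have hd2 := absM hd hd.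
  have hd3 := absM hd hd2.
  have h1 := absM hal' hd.
  have h2 := absM hbe hd2.
  have hYx : `|Y x| <= 21 / 50 * a.
    have hid : `|(i - 1 / 2) * G| <= 3 / 5 / 100 * (6 / 5 * a) by exact: absM.
    have h3 : G = (yp + yq) / 2 + (bq - bp) - xc * dy by rewrite /G /bq /bp; field.
    (* The leading term (yp + yq) / 8 appears; bp and bq are the sheared w coordinates, at most a /
       12, and the other terms are small errors. *)
    have E : Y x = (yp + yq) / 8 - 3 / 4 * (bq - bp) + 3 / 4 * (xc * dy) - 3 / 2 * ((i - 1 / 2) * G)
        + al' * (x - xc) + be * ((x - xc) * (x - xc)) / 2.
      by rewrite YE h3; field.
    rewrite E; move: hyp hyq hbp hbq hxd hid h1 h2 (absM hxc hdy); rewrite -/bp -/bq !ler_norml.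
    clear -a0; do 9 move=> /andP[? ?].
    by apply/andP; split; lra.
  split => //.
  rewrite WE -YE.
  have h3 : `|2 - D| <= 1 / 50 by rewrite ler_norml; clear -D1 D2; lra.
  have h4 := absM hdy h3.
  have h5 := absM hxc hYx.
  have hyc : `|(yp + yq) / 2| <= a by move: hyp hyq; rewrite !ler_norml; clear -a0 => /andP[? ?] /andP[? ?]; lra.
  have h6 := absM hxc hyc.
  have h7 := absM hal' hd2.
  have h8 := absM hbe hd3.
  move: h4 h5 h6 h7 h8 hbp hbq; rewrite -/bp -/bq !ler_norml.
  clear -a0; do 7 move=> /andP[? ?].
  by apply/andP; split; lra.
Qed.
End Midpoint.

(** * Localization of the midpoints between the two boxes *)

Section MidpointBox.
Variables (R : realType) (nrm : R * R -> R) (cx s c0 c1 k r : R).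

Definition box (x0 sg dx dy dw : R) : set (R * R * R) :=
  [set p | [/\ `|p.1.1 - x0| <= dx, `|yco s p| <= dy & `|wco s p - sg * yco s p| <= dw]].

(** The output of [window] with numerical constants: n r <= cx / 10^4 makes transversal
    contributions to the length negligible beside cx, and eta = 10^-12 is the square of the tilt d /
    r. *)
Definition window_data : Prop :=
  [/\ [/\ 0 < cx, 0 < k, 0 < r, `|c1| <= nrm (0, 1) & k * r <= 2 * nrm (0, 1)],
      forall x y, cx * `|x| <= nrm (x, y),
      nrm (0, 1) * r <= cx / 100 / 100 /\ cx * (99 / 100) <= c0 <= cx * (101 / 100),
      forall sg, `|sg| <= r -> nrm (1, s + sg) <= c0 + c1 * sg + k * sg ^+ 2 / 2 &
      forall tau, `|tau| <= r / 2 -> forall x y,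
        c0 * x + c1 * y + k * (tau * y - tau ^+ 2 * x / 2)
          <= nrm (x, s * x + y) + 2 * k * ((1 / 100 / 100 / 100) * (1 / 100 / 100 / 100)) * r ^+ 2 * `|x| ].

(** The shears w = - y / 2 here and w = y / 2 in [boxB] produce the contraction of y; the half-width
    r / 100 keeps the model slopes within r / 8, which leaves room in the window for tilting. *)
Definition boxA := box (- 1) (- (1 / 2)) (1 / 100) (r / 100) ((r / 100) / 12).
Definition boxB := box 1 (1 / 2) (1 / 100) (r / 100) ((r / 100) / 12).

End MidpointBox.

Lemma dist_AB (R : realType) (nrm : R * R -> R) (cx s c0 c1 k r : R) (p q : R * R * R) :
  is_norm nrm -> window_data nrm cx s c0 c1 k r -> boxA s r p -> boxB s r q ->
  exists al be : R,
  let Y x := yco s p + al * (x - p.1.1) + be * (x ^+ 2 - p.1.1 ^+ 2) / 2 in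
  let W x := wco s p + al * (x ^+ 2 - p.1.1 ^+ 2) / 2 + be * (x ^+ 3 - p.1.1 ^+ 3) / 3 in
  [/\ (sF_dist nrm p q <= (pot s c0 c1 k al be q - pot s c0 c1 k al be p)%:E)%E,
   forall x, `|x| <= 4 -> `|al + be * x| <= r / 8,
   pot s c0 c1 k al be q - pot s c0 c1 k al be p <= c0 * (q.1.1 - p.1.1) + c1 * (yco s q - yco s p) + nrm (0, 1) * (r / 100) / 10,
   forall x, `|x| <= 3 -> `|Y x| <= 60 * (r / 100) &
   forall x, `|x - (p.1.1 + q.1.1) / 2| <= 1 / 100 / 10 -> `|Y x| <= 21 / 50 * (r / 100) /\ `|W x| <= 5 / 4 * ((r / 100) / 12)].
Proof.
move=> Hn HW pA qB.
have [[cx0 k0 r0 hc1 hkr] hx [hnr hc0] hU hL] := HW.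
have [hxp hyp hwp] : [/\ `|p.1.1 + 1| <= 1 / 100, `|yco s p| <= (r / 100) & `|wco s p + yco s p / 2| <= (r / 100) / 12].
  case: pA => h1 h2 h3; split => //; first by move: h1; rewrite opprK.
  by move: h3; rewrite mulNr opprK div1r mulrC.
have [hxq hyq hwq] : [/\ `|q.1.1 - 1| <= 1 / 100, `|yco s q| <= (r / 100) & `|wco s q - yco s q / 2| <= (r / 100) / 12].
  by case: qB => h1 h2 h3; split => //; move: h3; rewrite div1r mulrC.
have n0 := norm_ge0 Hn; have nZ := normZ Hn.
have a0 : 0 < (r / 100) by rewrite divr_gt0.
have [al [be [[EY EW] ht hI hY hYW]]] := interpolation a0 hxp hxq hyp hyq hwp hwq.
have ht' x : `|x| <= 4 -> `|al + be * x| <= r / 8.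
  by move=> /ht h; apply: le_trans h _; clear -r0; lra.
move: (hxp) (hxq); rewrite !ler_norml => /andP[xp1 xp2] /andP[xq1 xq2].
exists al, be; split => //.
- apply: (@upper_bound _ nrm s c0 c1 k r) => //.
  + by clear -xp1 xp2 xq1 xq2; lra.
  + move=> x /andP[px xq]; apply: le_trans (ht' x _) _; last by clear -r0; lra.
    by rewrite ler_norml; clear -px xq xp1 xq2; lra.
  + by rewrite -EY; ring.
  + by rewrite -EW; ring.
- have -> : pot s c0 c1 k al be q - pot s c0 c1 k al be p =
    c0 * (q.1.1 - p.1.1) + c1 * (yco s q - yco s p) + k * (al ^+ 2 * (q.1.1 - p.1.1)
      + al * be * (q.1.1 ^+ 2 - p.1.1 ^+ 2) + be ^+ 2 * (q.1.1 ^+ 3 - p.1.1 ^+ 3) / 3) / 2.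
    by rewrite /pot -EY -EW; field.
  rewrite lerD2l ler_pdivrMr//; apply: le_trans (ler_wpM2l (ltW k0) hI) _.
  have : k * r * (r / 100) <= 2 * nrm (0, 1) * (r / 100) by rewrite ler_pM2r.
  have : 0 <= nrm (0, 1) * (r / 100) by rewrite mulr_ge0// ltW.
  by clear -a0; lra.
Qed.

(** The distance dv is at most the calibrated value from p to q, and each half is at least its own
    calibrated value up to an error. The part c0 x + c1 y alone locates m along x; the tilted
    calibrations locate it transversally. *)
Lemma midpoint_box (R : realType) (nrm : R * R -> R) (cx s c0 c1 k r : R) (p q m : R * R * R) (dv : R) :
  is_norm nrm -> window_data nrm cx s c0 c1 k r -> boxA s r p -> boxB s r q ->
  sF_dist nrm p q = dv%:E -> sF_dist nrm p m = (dv / 2)%:E ->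
  sF_dist nrm m q = (dv / 2)%:E ->
  box s 0 0 (11 / 10 / 100) (9 / 20 * (r / 100)) (13 / 10 * ((r / 100) / 12)) m.
Proof.
move=> Hn HW pA qB dpq dpm dmq.
have [[cx0 k0 r0 hc1 hkr] hx [hnr hc0] hU hL] := HW.
have [hxp hyp hwp] : [/\ `|p.1.1 + 1| <= 1 / 100, `|yco s p| <= (r / 100) & `|wco s p + yco s p / 2| <= (r / 100) / 12].
  case: pA => h1 h2 h3; split => //; first by move: h1; rewrite opprK.
  by move: h3; rewrite mulNr opprK div1r mulrC.
have [hxq hyq hwq] : [/\ `|q.1.1 - 1| <= 1 / 100, `|yco s q| <= (r / 100) & `|wco s q - yco s q / 2| <= (r / 100) / 12].
  by case: qB => h1 h2 h3; split => //; move: h3; rewrite div1r mulrC.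
have n0 := norm_ge0 Hn; have nZ := normZ Hn.
have a0 : 0 < (r / 100) by rewrite divr_gt0.
have nn : 0 <= nrm (0, 1) by exact: n0.
have na0 : 0 <= nrm (0, 1) * (r / 100) by rewrite mulr_ge0// ltW.
have [al [be]] := dist_AB Hn HW pA qB.
set Y := fun x => yco s p + _ + _; set W := fun x => wco s p + _ + _.
move=> /= [dD ht hD hY hYW].
have {}dD : dv <= pot s c0 c1 k al be q - pot s c0 c1 k al be p by rewrite -lee_fin -dpq.
have {}hD := le_trans dD hD.
move: (hxp) (hxq); rewrite !ler_norml => /andP[xp1 xp2] /andP[xq1 xq2].
have hdy : `|yco s q - yco s p| <= 2 * (r / 100).
  by move: hyp hyq; rewrite !ler_norml; clear -a0 => /andP[? ?] /andP[? ?]; lra.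
have hdv : dv <= 21 / 10 * cx.
  have h1 : c0 * (q.1.1 - p.1.1) <= cx * (101 / 100) * (101 / 50).
    by apply: ler_pM; move: hc0; clear -xp1 xp2 xq1 xq2 cx0 => /andP[? ?]; lra.
  have h2 := absM hc1 hdy.
  have := ler_norm (c1 * (yco s q - yco s p)).
  by clear -hD h1 h2 na0 cx0 hnr; lra.
pose eps := 2 * k * ((1 / 100 / 100 / 100) * (1 / 100 / 100 / 100)) * r ^+ 2.
have eps0 : 0 <= eps.
  rewrite /eps; apply: mulr_ge0; last exact: sqr_ge0.
  by clear -k0; lra.
have hepsE : eps = 2 * ((1 / 100 / 100 / 100) * (1 / 100 / 100 / 100)) * (k * r) * r by rewrite /eps; ring.
(* Each half has length at most 21/20 cx < 3/2 cx, hence the range 3/2 for x and the error 3/2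
   eps. *)
have lb1 al' be' p1 q1 : (forall x, `|q1.1.1 - x| <= 3 / 2 -> `|al' + be' * x| <= r / 2) ->
    sF_dist nrm p1 q1 = (dv / 2)%:E ->
    `|q1.1.1 - p1.1.1| <= 21 / 20 /\
    pot s c0 c1 k al' be' q1 - pot s c0 c1 k al' be' p1 <= dv / 2 + 3 / 2 * eps.
  move=> hr d1.
  have [|||h1 h2] := @lower_bound _ nrm s c0 c1 k eps cx (r / 2) al' be' (dv / 2) (3 / 2 * cx) p1 q1 n0 cx0 eps0 hx hL.
  - by clear -hdv cx0; lra.
  - by move=> x; rewrite mulrC ler_pM2r// => /hr.
  - by rewrite d1.
  split.
    by rewrite -(ler_pM2l cx0); apply: le_trans h1 _; clear -hdv cx0; lra.
  apply: le_trans h2 _; rewrite mulrDl mul1r lerD2l mulrAC -mulrA mulrC ler_wpM2r//.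
  by rewrite ler_pdivrMr//; clear -hdv cx0; lra.
have [xmp _] : `|m.1.1 - p.1.1| <= 21 / 20 /\ pot s c0 c1 k 0 0 m - pot s c0 c1 k 0 0 p <= dv / 2 + 3 / 2 * eps.
  by apply: lb1 => // x _; rewrite mul0r addr0 normr0; clear -r0; lra.
(* Perturbing the calibration by A + B x on the first half only detects the
   deviation of m from the model curve. *)
have key A B : (forall x, `|x| <= 4 -> `|A + B * x| <= r / 4) ->
    A * (yco s m - Y m.1.1) + B * (wco s m - W m.1.1) <=
    (A ^+ 2 * (m.1.1 - p.1.1) + A * B * (m.1.1 ^+ 2 - p.1.1 ^+ 2) + B ^+ 2 * (m.1.1 ^+ 3 - p.1.1 ^+ 3) / 3) / 2
     + 6 * ((1 / 100 / 100 / 100) * (1 / 100 / 100 / 100)) * r ^+ 2.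
  move=> hAB.
  have [|_ l1] := lb1 (al + A) (be + B) p m _ dpm.
    move=> x hxx; have x4 : `|x| <= 4.
      by move: hxx xmp; rewrite !ler_norml; clear -xp1 xp2 => /andP[? ?] /andP[? ?]; lra.
    rewrite (_ : al + A + (be + B) * x = (al + be * x) + (A + B * x)); last by ring.
    apply: le_trans (ler_normD _ _) _; have := ht x x4; have := hAB x x4; clear -r0; lra.
  have [|_ l2] := lb1 al be m q _ dmq.
    move=> x hxx; have x4 : `|x| <= 4.
      by move: hxx; rewrite !ler_norml; clear -xq1 xq2 => /andP[? ?]; lra.
    by apply: le_trans (ht x x4) _; clear -r0; lra.
  rewrite -(ler_pM2l k0).
  have E : pot s c0 c1 k (al + A) (be + B) m - pot s c0 c1 k (al + A) (be + B) p
     - (pot s c0 c1 k al be m - pot s c0 c1 k al be p) =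
    k * (A * (yco s m - Y m.1.1) + B * (wco s m - W m.1.1)) - k * ((A ^+ 2 * (m.1.1 - p.1.1) + A * B * (m.1.1 ^+ 2 - p.1.1 ^+ 2) + B ^+ 2 * (m.1.1 ^+ 3 - p.1.1 ^+ 3) / 3) / 2).
    by rewrite /pot /Y /W; field.
  rewrite [leRHS]mulrDr -lerBlDl -E (_ : k * _ = 3 * eps); last by rewrite /eps; field.
  by move: dD l1 l2; clear; lra.
(* The tilt equals sqrt(eta) r, which balances its quadratic cost against the window error. *)
pose d := (1 / 100 / 100 / 100) * r.
have d0 : 0 < d by rewrite /d; clear -r0; lra.
have dd2 : (1 / 100 / 100 / 100) * (1 / 100 / 100 / 100) * r ^+ 2 = d * d by rewrite /d; ring.
have m3 : `|m.1.1| <= 21 / 10.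
  by move: xmp; rewrite !ler_norml; clear -xp1 xp2 => /andP[? ?]; lra.
have hp1 : `|p.1.1| <= 101 / 100 by rewrite ler_norml; clear -xp1 xp2; lra.
have sq (u : R) : `|u| = 1 -> u ^+ 2 = 1 by move=> u1; rewrite -real_normK ?num_real// u1 expr1n.
have ey : `|yco s m - Y m.1.1| <= 7 * d.
  have K u : `|u| = 1 -> u * (yco s m - Y m.1.1) <= 7 * d.
    move=> u1.
    have hk x : `|x| <= 4 -> `|u * d + 0 * x| <= r / 4.
      by move=> _; rewrite mul0r addr0 normrM u1 mul1r gtr0_norm// /d; clear -r0; lra.
    have := key _ _ hk; rewrite mul0r addr0 [leRHS](_ : _ = d ^+ 2 * (m.1.1 - p.1.1) / 2 + 6 * (d * d)); last first.
      by rewrite exprMn (sq _ u1) /d; field.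
    move=> h; rewrite -(ler_pM2r d0) mulrAC; apply: le_trans h _.
    have h1 : d ^+ 2 * (m.1.1 - p.1.1) <= d ^+ 2 * (21 / 20).
      by rewrite ler_pM2l ?exprn_gt0//; apply: le_trans (ler_norm _) _.
    have : 0 < d ^+ 2 by rewrite exprn_gt0.
    by move: h1; rewrite expr2; clear; lra.
  rewrite ler_norml; have := K 1 (normr1 _); have := K (-1) (normrN1 _).
  by clear; move=> ? ?; apply/andP; split; lra.
have ew : `|wco s m - W m.1.1| <= 10 * d.
  have K u : `|u| = 1 -> u * (wco s m - W m.1.1) <= 10 * d.
    move=> u1.
    have hk x : `|x| <= 4 -> `|0 + u * d * x| <= r / 4.
      rewrite add0r normrM (normrM u d) u1 mul1r (gtr0_norm d0) => hx4.
      by apply: le_trans (ler_wpM2l (ltW d0) hx4) _; rewrite /d; clear -r0; lra.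
    have := key _ _ hk; rewrite mul0r add0r [leRHS](_ : _ = d ^+ 2 * (m.1.1 ^+ 3 - p.1.1 ^+ 3) / 6 + 6 * (d * d)); last first.
      by rewrite exprMn (sq _ u1) /d; field.
    move=> h; rewrite -(ler_pM2r d0) mulrAC; apply: le_trans h _.
    have h1 : d ^+ 2 * (m.1.1 ^+ 3 - p.1.1 ^+ 3) <= d ^+ 2 * 12.
      rewrite ler_pM2l ?exprn_gt0//.
      have := absM m3 (absM m3 m3); have := absM hp1 (absM hp1 hp1).
      rewrite -!expr2 -!exprS !ler_norml; clear => /andP[? ?] /andP[? ?]; lra.
    have : 0 < d ^+ 2 by rewrite exprn_gt0.
    by move: h1; rewrite expr2; clear; lra.
  rewrite ler_norml; have := K 1 (normr1 _); have := K (-1) (normrN1 _).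
  by clear; move=> ? ?; apply/andP; split; lra.
have da : 10 * d <= (r / 100) / 1000 by rewrite /d; clear -r0; lra.
(* A crude bound valid wherever m lies along x; it is used to show that m is near the middle, after
   which the sharp bound applies. *)
have hym : `|yco s m - (yco s p + yco s q) / 2| <= 62 * (r / 100).
  have m33 : `|m.1.1| <= 3 by apply: le_trans m3 _; clear; lra.
  have := hY m.1.1 m33.
  by move: ey hyp hyq da d0; rewrite !ler_norml; clear -a0 => /andP[? ?] /andP[? ?] /andP[? ?] ? ? /andP[? ?]; lra.
have hdx : `|m.1.1 - (p.1.1 + q.1.1) / 2| <= 1 / 100 / 10.
  have c00 : 0 < c0 by move: hc0; clear -cx0 => /andP[? ?]; lra.
  have [|_ l1] := lb1 0 0 p m _ dpm; first by move=> x _; rewrite mul0r addr0 normr0; clear -r0; lra.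
  have [|_ l2] := lb1 0 0 m q _ dmq; first by move=> x _; rewrite mul0r addr0 normr0; clear -r0; lra.
  have h := absM hc1 hym.
  have heps : eps <= nrm (0, 1) * r.
    rewrite hepsE; apply: ler_wpM2r; first exact: ltW.
    by move: hkr nn; clear; lra.
  suff : c0 * `|m.1.1 - (p.1.1 + q.1.1) / 2| <= 4 * (nrm (0, 1) * r).
    move=> h4; rewrite -(ler_pM2l c00); apply: le_trans h4 _.
    by move: hnr hc0; clear -cx0 => h1 /andP[h2 _]; lra.
  rewrite -(ger0_norm (ltW c00)) -normrM ler_norml.
  move: h l1 l2 hD heps; rewrite /pot ler_norml; clear -na0 => /andP[? ?] l1 l2 hD heps.
  by apply/andP; split; lra.
have [h1 h2] := hYW _ hdx.
rewrite /box /= subr0 mul0r subr0; split.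
- by move: hdx; rewrite !ler_norml; clear -xp1 xp2 xq1 xq2 => /andP[? ?]; lra.
- by move: h1 ey; rewrite !ler_norml; clear -d0 a0 da => /andP[? ?] /andP[? ?]; lra.
- by move: h2 ew; rewrite !ler_norml; clear -d0 a0 da => /andP[? ?] /andP[? ?]; lra.
Qed.

Lemma window_data_exists (R : realType) (nrm : R * R -> R) :
  is_norm nrm -> norm_C1 nrm -> norm_strongly_convex nrm ->
  exists cx s c0 c1 k r : R, window_data nrm cx s c0 c1 k r.
Proof.
move=> Hn HC HS; have [cx [cx0 hx hw]] := window Hn HC HS.
have n0 := n_gt0 Hn.
have rm0 : 0 < cx / 100 / 100 / nrm (0, 1) by rewrite !divr_gt0.
have e0 : 0 < (1 / 100 / 100 / 100) * (1 / 100 / 100 / 100) :> R by rewrite mulr_gt0 ?divr_gt0.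
have [s [c0 [c1 [k [r [[k0 r0 rrm hc1 kr] hc0 hU hL]]]]]] := hw _ _ e0 rm0.
exists cx, s, c0, c1, k, r; split => //.
split; first by rewrite mulrC -ler_pdivlMr.
  by move: hc0; rewrite mulrC divfK ?gt_eqF//; clear -cx0 => /andP[? ?]; apply/andP; split; lra.
Qed.

(** * Anisotropic dilations *)

Section Dilation.
Variable R : realType.
Implicit Types (nrm : R * R -> R) (p q : R * R * R).

(** The weight l^2 on z is forced by dz = (x dy - y dx) / 2: horizontal curves then stay horizontal
    and their controls are multiplied by l. *)
Definition dil (l : R) p : R * R * R := (l * p.1.1, l * p.1.2, l ^+ 2 * p.2).

Lemma dilK (l : R) : l != 0 -> cancel (dil l) (dil l^-1).
Proof.
move=> l0 [[x y] z]; rewrite /dil /= !mulKf//; congr pair.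
by rewrite exprVn mulKf// expf_neq0.
Qed.

Lemma sF_dist_dil_le nrm l p q : is_norm nrm -> 0 < l ->
  (sF_dist nrm (dil l p) (dil l q) <= l%:E * sF_dist nrm p q)%E.
Proof.
move=> Hn l0.
have l00 : l != 0 by rewrite gt_eqF.
suff : (l^-1%:E * sF_dist nrm (dil l p) (dil l q) <= sF_dist nrm p q)%E.
  move=> h; rewrite -[X in (X <= _)%E]mul1e -(divff l00) EFinM -muleA.
  by rewrite lee_pmul2l ?lte_fin.
apply/ereal_infP => L [g [u [[[ax ay az] [mu1 i1] [mu2 i2] ae] gp gq ->]]].
have -> : curve_length nrm u = (l^-1%:E * (l%:E * curve_length nrm u))%E.
  by rewrite muleA -EFinM mulVf// mul1e.
rewrite lee_pmul2l ?lte_fin ?invr_gt0//.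
apply: (@le_trans _ _ (curve_length nrm (fun t => l *: u t))); last first.
  rewrite /curve_length; under eq_integral do rewrite (normZ Hn) gtr0_norm//.
  by apply: nonneg_integralZ_le => // t; exact: norm_ge0.
apply: ereal_inf_lbound; exists (fun t => dil l (g t)), (fun t => l *: u t); split => //; last 2 first.
- by rewrite gp.
- by rewrite gq.
have L2Z f : L2_01 f -> L2_01 (fun t => l * f t).
  move=> [mf jf]; split; first by apply: measurable_funM => //; exact: measurable_cst.
  under eq_integral do rewrite exprMn.
  apply: le_lt_trans (nonneg_integralZ_le _ _ _ _) _ => //; first by rewrite exprn_gt0.
    by move=> x; exact: sqr_ge0.
  by rewrite lte_mul_pinfty// lee_fin sqr_ge0.
split.
- by split; exact: abs_cont01Z.
- exact: L2Z.
- exact: L2Z.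
- apply: (@filterS _ _ (ae_filter_ringOfSetsType (@lebesgue_measure R))) ae => t + tt => /(_ tt) [dx dy dz].
  split; [exact: is_deriveZf|exact: is_deriveZf|].
  apply: (is_derive_eq (is_deriveZf (l ^+ 2) dz)).
  by rewrite /dil /= /GRing.scale /=; field.
Qed.

Lemma sF_dist_dil nrm l p q : is_norm nrm -> 0 < l ->
  sF_dist nrm (dil l p) (dil l q) = (l%:E * sF_dist nrm p q)%E.
Proof.
move=> Hn l0; apply/eqP; rewrite eq_le sF_dist_dil_le//=.
have l00 : l != 0 by rewrite gt_eqF.
have li0 : 0 < l^-1 by rewrite invr_gt0.
have := sF_dist_dil_le (dil l p) (dil l q) Hn li0; rewrite !dilK// => h.
rewrite -[leRHS]mul1e -(divff l00) EFinM -muleA lee_pmul2l// lte_fin.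
Qed.

Lemma sF_dist_ge0 nrm p q : is_norm nrm -> (0 <= sF_dist nrm p q)%E.
Proof.
move=> Hn; apply/ereal_infP => L [g [u [_ _ _ ->]]].
by apply: integral_ge0 => t _; rewrite lee_fin; exact: norm_ge0.
Qed.
End Dilation.

(** * Volumes of sheared boxes *)

Section Volume.
Variable R : realType.
Notation mu := (@lebesgue_measure R).

Lemma measurable_le_cst d (T : measurableType d) (f : T -> R) (c : R) :
  measurable_fun setT f -> measurable [set x | f x <= c].
Proof.
move=> mf; have := mf measurableT `]-oo, c]%classic (measurable_itv _).
by rewrite setTI; congr measurable; apply/seteqP; split => x /=; rewrite in_itv.
Qed.

Definition gbox (s x0 y0 sg w0 dx dy dw : R) : set (R * R * R) :=
  [set p | [/\ `|p.1.1 - x0| <= dx, `|yco s p - y0| <= dy & `|wco s p - sg * yco s p - w0| <= dw]].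

Lemma measurable_gbox (s x0 y0 sg w0 dx dy dw : R) : measurable (gbox s x0 y0 sg w0 dx dy dw).
Proof.
have mx : measurable_fun setT (fun p : R * R * R => p.1.1).
  by apply: (measurableT_comp measurable_fst measurable_fst).
have my : measurable_fun setT (fun p : R * R * R => p.1.2).
  by apply: (measurableT_comp measurable_snd measurable_fst).
have mz : measurable_fun setT (fun p : R * R * R => p.2) by exact: measurable_snd.
have mc (c : R) : measurable_fun setT (fun=> c : R) by move=> d T; exact: measurable_cst.
have myc : measurable_fun setT (yco s).
  by apply: measurable_funB => //; apply: measurable_funM => //; exact: measurable_cst.
have mwc : measurable_fun setT (wco s).
  apply: measurable_funD => //; apply: measurable_funM; last exact: measurable_cst.
  exact: measurable_funM.
rewrite (_ : gbox _ _ _ _ _ _ _ _ = [set p | `|p.1.1 - x0| <= dx] `&` ([set p | `|yco s p - y0| <= dy] `&`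
   [set p | `|wco s p - sg * yco s p - w0| <= dw])); last first.
  by apply/seteqP; split => p /=; [case|case=> ? []].
apply: measurableI; last apply: measurableI; apply: measurable_le_cst;
  apply: (measurableT_comp (@normr_measurable R setT)) => //.
- by apply: measurable_funB => //; exact: measurable_cst.
- by apply: measurable_funB => //; exact: measurable_cst.
- apply: measurable_funB; last exact: measurable_cst.
  by apply: measurable_funB => //; apply: measurable_funM => //; exact: measurable_cst.
Qed.

Lemma lebesgue_measure_ball_itv (c e : R) : 0 <= e ->
  mu [set z | `|z - c| <= e] = (2 * e)%:E.
Proof.
move=> e0; rewrite (_ : [set z | _] = `[c - e, c + e]%classic); last first.
  by apply/seteqP; split => z /=; rewrite in_itv/= ler_distl.
rewrite lebesgue_measure_itv/= lte_fin; case: ltP => h; last first.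
  have e00 : e = 0 by lra.
  by rewrite e00 mulr0.
by rewrite -EFinB; congr EFin; ring.
Qed.

Lemma product_measure1_fibers d1 d2 (T1 : measurableType d1) (T2 : measurableType d2)
    (m1 : {measure set T1 -> \bar R}) (m2 : {measure set T2 -> \bar R})
    (A : set (T1 * T2)) (P : set T1) (c : R) : measurable P ->
  (forall x, P x -> m2 [set y | A (x, y)] = c%:E) ->
  (forall x y, A (x, y) -> P x) ->
  (m1 \x m2)%E A = (c%:E * m1 P)%E.
Proof.
move=> mP hA hN; rewrite /product_measure1 -integral_cst// [RHS]integral_mkcond.
apply: eq_integral => x _ /=; rewrite patchE; case: ifPn => [/set_mem Px|nP].
  rewrite -(hA x Px); congr (m2 _).
  by apply/seteqP; split => y; rewrite /xsection /= inE.
rewrite (_ : xsection _ _ = set0) ?measure0//.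
apply/seteqP; split => y //; rewrite /xsection /= inE => /hN Px.
by move/negP: nP; apply; apply/mem_set.
Qed.

(** The shears only translate the fibres: over each (x, y) the fibre is an interval of length 2 dw,
    and over each x the y-fibre has length 2 dy. *)
Lemma volume_gbox (s x0 y0 sg w0 dx dy dw : R) : 0 <= dx -> 0 <= dy -> 0 <= dw ->
  Leb3 (gbox s x0 y0 sg w0 dx dy dw) = (8 * dx * dy * dw)%:E.
Proof.
move=> dx0 dy0 dw0.
pose P : set (R * R) := [set v | `|v.1 - x0| <= dx /\ `|v.2 - s * v.1 - y0| <= dy].
have mP : measurable P.
  rewrite (_ : P = [set v | `|v.1 - x0| <= dx] `&` [set v | `|v.2 - s * v.1 - y0| <= dy])//.
  apply: measurableI; apply: measurable_le_cst;
    apply: (measurableT_comp (@normr_measurable R setT)) => //.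
    by apply: measurable_funB => //; exact: measurable_cst.
  apply: measurable_funB; last exact: measurable_cst.
  by apply: measurable_funB => //; apply: measurable_funM => //; exact: measurable_cst.
apply: etrans (@product_measure1_fibers _ _ _ _ (mu \x mu)%E mu (gbox s x0 y0 sg w0 dx dy dw) P (2 * dw) mP _ _) _.
- move=> v [h1 h2].
  rewrite -(lebesgue_measure_ball_itv (sg * (v.2 - s * v.1) - v.1 * (v.2 - s * v.1) / 2 + w0) dw0); congr mu.
  apply/seteqP; split => z; rewrite /gbox /= /wco /yco /=.
    by case=> _ _; rewrite (_ : z + _ - _ - _ = z - (sg * (v.2 - s * v.1) - v.1 * (v.2 - s * v.1) / 2 + w0))//; ring.
  by move=> h; split => //; rewrite (_ : z + _ - _ - _ = z - (sg * (v.2 - s * v.1) - v.1 * (v.2 - s * v.1) / 2 + w0))//; ring.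
- by move=> v z [h1 h2 _].
pose I := [set x : R | `|x - x0| <= dx].
have mI : measurable I.
  apply: measurable_le_cst; apply: (measurableT_comp (@normr_measurable R setT)) => //.
  by apply: measurable_funB => //; exact: measurable_cst.
rewrite [X in (_ * X)%E](@product_measure1_fibers _ _ _ _ mu mu P I (2 * dy) mI); last 2 first.
- by move=> x h1; rewrite -(lebesgue_measure_ball_itv (s * x + y0) dy0); congr mu; apply/seteqP; split => z /=; rewrite opprD addrA => // -[].
- by move=> x z [].
by rewrite [X in (_ * (_ * X))%E](lebesgue_measure_ball_itv x0 dx0) -!EFinM; congr EFin; ring.
Qed.

Lemma box_gbox (s x0 sg dx dy dw : R) : box s x0 sg dx dy dw = gbox s x0 0 sg 0 dx dy dw.
Proof. by apply/seteqP; split => p; rewrite /box /gbox /= !subr0. Qed.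

Lemma measurable_box (s x0 sg dx dy dw : R) : measurable (box s x0 sg dx dy dw).
Proof. rewrite box_gbox; exact: measurable_gbox. Qed.

Lemma volume_box (s x0 sg dx dy dw : R) : 0 <= dx -> 0 <= dy -> 0 <= dw ->
  Leb3 (box s x0 sg dx dy dw) = (8 * dx * dy * dw)%:E.
Proof. by rewrite box_gbox; exact: volume_gbox. Qed.

(** The slope sg scales by l because w scales by l^2 and y by l. *)
Lemma box_dil (s x0 sg dx dy dw l : R) p : 0 < l ->
  box s (l * x0) (l * sg) (l * dx) (l * dy) (l ^+ 2 * dw) (dil l p) <-> box s x0 sg dx dy dw p.
Proof.
move=> l0; have l20 : 0 < l ^+ 2 by rewrite exprn_gt0.
have gl := gtr0_norm l0; have gl2 := gtr0_norm l20.
rewrite /box /=.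
rewrite (_ : l * p.1.1 - l * x0 = l * (p.1.1 - x0)); last by ring.
rewrite (_ : yco s (dil l p) = l * yco s p); last by rewrite /yco /dil /=; ring.
rewrite (_ : wco s (dil l p) - _ = l ^+ 2 * (wco s p - sg * yco s p)); last first.
  by rewrite /wco /yco /dil /=; field.
by rewrite !(normrM l) (normrM (l ^+ 2)) gl gl2 !ler_pM2l.
Qed.
End Volume.

(** * Density estimates and the support of the measure *)

Lemma smooth_measure_ge (R : realType) (rho : R * R * R -> R) (S E : set (R * R * R)) (c : R) :
  (forall p, 0 < rho p) ->
  measurable S -> S `<=` E -> 0 <= c -> (forall p, S p -> c <= rho p) ->
  (c%:E * Leb3 S <= smooth_measure rho E)%E.
Proof.
move=> rho0 mS SE c0 hc; rewrite /smooth_measure /Leb3 -integral_cst//.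
rewrite integral_mkcond [leRHS]integral_mkcond.
apply: nonneg_integral_le => p _; rewrite !patchE; first by case: ifP; rewrite ?lee_fin.
case: ifPn => [/set_mem Sp|_].
  by rewrite mem_set ?lee_fin; [exact: hc|exact: SE].
by case: ifP => _ //; rewrite lee_fin ltW.
Qed.

Lemma smooth_measure_le (R : realType) (rho : R * R * R -> R) (E : set (R * R * R)) (c : R) :
  (forall p, 0 < rho p) ->
  measurable E -> (forall p, E p -> rho p <= c) -> (smooth_measure rho E <= c%:E * Leb3 E)%E.
Proof.
move=> rho0 mE hc; rewrite /smooth_measure /Leb3 -integral_cst//.
by apply: nonneg_integral_le => p Ep; rewrite lee_fin; first [exact: ltW (rho0 p)|exact: hc].
Qed.

Lemma continuous_at_box (R : realType) (rho : R * R * R -> R) p : {for p, continuous rho} -> forall e : R, 0 < e ->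
  exists2 d : R, 0 < d & forall q, `|q.1.1 - p.1.1| < d -> `|q.1.2 - p.1.2| < d ->
    `|q.2 - p.2| < d -> `|rho q - rho p| < e.
Proof.
move=> cr e e0; move/cvgrPdist_lt : cr => /(_ e e0) /nbhs_ballP[d /= d0 hd].
exists d => // q h1 h2 h3; rewrite distrC; apply: hd.
by split; [split|]; rewrite /ball/= distrC.
Qed.

(** Each ball contains a small box placed to the right of p: its points are joined to p by curves
    monotone in x with slope at most 1, whose length is at most M times the x-displacement. The box
    is sheared with slope xp since dw = x dy with x near xp. *)
Lemma spt_full (R : realType) (rho : R * R * R -> R) nrm p : (forall p, 0 < rho p) -> is_norm nrm -> {for p, continuous rho} ->
  spt (sF_dist nrm) (smooth_measure rho) p.
Proof.
move=> rho0 Hn cr rr rr0.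
have n0 := n_gt0 Hn.
have rp2 : 0 < rho p / 2 by rewrite divr_gt0.
have [d d0 hd] := continuous_at_box cr rp2.
pose M := nrm (1, 0) + nrm (0, 1).
have M0 : 0 < M by rewrite ltr_wpDl ?norm_ge0.
set xp := p.1.1; set yp := yco 0 p; set wp := wco 0 p.
have ypE : yp = p.1.2 by rewrite /yp /yco mul0r subr0.
pose C := 1 + `|xp| + 3 * (`|yp| + 1) + `|xp|.
have C1 : 1 <= C by rewrite /C; have := normr_ge0 xp; have := normr_ge0 yp; clear; lra.
have C0 : 0 < C by exact: lt_le_trans C1.
pose h := Num.min 1 (Num.min (d / (4 * C)) (rr / (4 * M))).
have h0 : 0 < h by rewrite !lt_min ltr01 !divr_gt0 ?mulr_gt0.
have h1 : h <= 1 by rewrite /h ge_min lexx.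
have hd' : 4 * (C * h) <= d.
  by rewrite mulrA mulrC -ler_pdivlMr ?mulr_gt0// /h !ge_min lexx !orbT.
have hM : 4 * (M * h) <= rr.
  by rewrite mulrA mulrC -ler_pdivlMr ?mulr_gt0// /h !ge_min lexx !orbT.
(* The offset 2 h keeps the x-displacement between h and 3 h; the widths h / 20 and h^2 / 20 make
   the interpolating slope at most 1. *)
pose S : set (R * R * R) := [set q | [/\ `|q.1.1 - (xp + 2 * h)| <= h, `|yco 0 q - yp| <= h / 20 &
   `|wco 0 q - xp * yco 0 q - (wp - xp * yp)| <= h * h / 20]].
have mS : measurable S by exact: (measurable_gbox 0 (xp + 2 * h) yp xp (wp - xp * yp) h (h / 20) (h * h / 20)).
have hS : Leb3 S = (8 * h * (h / 20) * (h * h / 20))%:E.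
  by apply: (volume_gbox 0 (xp + 2 * h) yp xp (wp - xp * yp)); rewrite ?divr_ge0 ?mulr_ge0 ?ltW.
have hh : h * h <= h by rewrite ler_piMr// ltW.
have rS q : S q -> rho p / 2 <= rho q.
  case=> s1 s2 s3.
  have yqE : yco 0 q = q.1.2 by rewrite /yco mul0r subr0.
  have sx : `|q.1.1 - xp| <= 3 * h.
    by move: s1; rewrite !ler_norml; clear => /andP[? ?]; apply/andP; split; lra.
  have hCh : 3 * h <= 3 * (C * h) by rewrite ler_pM2l// ler_peMl// ltW.
  have dz : `|q.2 - p.2| <= C * h.
    have E : q.2 - p.2 = (wco 0 q - xp * yco 0 q - (wp - xp * yp)) + xp * (yco 0 q - yp)
       - ((q.1.1 - xp) * ((yco 0 q - yp) + yp) + xp * (yco 0 q - yp)) / 2.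
      by rewrite /wp /yp /wco /xp; field.
    have k1 := absM (lexx `|xp|) s2.
    have k2 : `|(yco 0 q - yp) + yp| <= `|yp| + 1.
      by apply: le_trans (ler_normD _ _) _; move: s2 h1 h0; clear; lra.
    have k3 := absM sx k2.
    have x0 : 0 <= `|xp| * h by rewrite mulr_ge0// ltW.
    have y0 : 0 <= `|yp| * h by rewrite mulr_ge0// ltW.
    rewrite E /C; move: s3 k1 k3 hh h0 x0 y0; clear.
    rewrite !ler_norml => /andP[? ?] /andP[? ?] /andP[? ?] ? ? ? ?.
    by apply/andP; split; lra.
  have Ch0 : 0 < C * h by rewrite mulr_gt0.
  have := hd q; rewrite -/xp -ypE -yqE.
  have t1 : `|q.1.1 - xp| < d by move: sx hCh hd' Ch0; clear; lra.
  have t2 : `|yco 0 q - yp| < d by move: s2 hCh hd' Ch0 h0; clear; lra.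
  have t3 : `|q.2 - p.2| < d by move: dz hd' Ch0; clear; lra.
  move=> /(_ t1 t2 t3); rewrite ltr_norml => /andP[]; clear; lra.
have Sball : S `<=` [set q | (sF_dist nrm p q < rr%:E)%E].
  move=> q [s1 s2 s3] /=.
  pose D := q.1.1 - xp.
  have [D1 D2] : h <= D /\ D <= 3 * h.
    by move: s1; rewrite ler_norml /D; clear => /andP[? ?]; split; lra.
  have D0 : 0 < D by exact: lt_le_trans D1.
  have DN0 : D != 0 by rewrite gt_eqF.
  pose dy := yco 0 q - yp; pose G := (wco 0 q - wp) - (xp + D / 2) * dy.
  pose xc := xp + D / 2.
  pose be := 12 * G / D ^+ 3; pose al := dy / D - be * xc.
  have dyD : `|dy / D| <= 1 / 20.
    rewrite normrM normfV (gtr0_norm D0) ler_pdivrMr//.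
    by apply: le_trans s2 _; move: D1; clear; lra.
  have GD : `|G / (D * D)| <= 1 / 10.
    rewrite normrM normfV (gtr0_norm (mulr_gt0 D0 D0)) ler_pdivrMr ?mulr_gt0//.
    have -> : G = (wco 0 q - xp * yco 0 q - (wp - xp * yp)) - D * dy / 2 by rewrite /G /dy; field.
    have k1 : h * h <= D * D by apply: ler_pM => //; exact: ltW.
    have k2 : `|D * dy| <= D * (D / 20).
      rewrite normrM (gtr0_norm D0) ler_pM2l//; apply: le_trans s2 _; move: D1; clear; lra.
    have DD0 : 0 < D * D by rewrite mulr_gt0.
    move: s3 k1 k2 DD0; clear; rewrite !ler_norml => /andP[? ?] ? /andP[? ?] ?.
    by apply/andP; split; lra.
  have tau x : xp <= x <= q.1.1 -> `|al + be * x| <= 1.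
    move=> /andP[x1 x2].
    have -> : al + be * x = dy / D + 12 * ((G / (D * D)) * ((x - xc) / D)).
      by rewrite /al /be; field.
    have k1 : `|(x - xc) / D| <= 1 / 2.
      rewrite normrM normfV (gtr0_norm D0) ler_pdivrMr// ler_norml.
      by move: x1 x2; rewrite /xc /D; clear => ? ?; apply/andP; split; lra.
    have k2 := absM GD k1.
    move: dyD k2; clear; rewrite !ler_norml => /andP[? ?] /andP[? ?].
    by apply/andP; split; lra.
  have Dq : q.1.1 = xp + D by rewrite /D; ring.
  apply: (@le_lt_trans _ _ (M * D)%:E); last first.
    rewrite lte_fin; have k : M * D <= M * (3 * h) by rewrite ler_pM2l.
    have : 0 < M * h by rewrite mulr_gt0.
    by move: k hM; clear; lra.
  have := @upper_bound _ nrm 0 M 0 0 1 al be p q (norm_ge0 Hn) (normZ Hn).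
  rewrite (_ : pot 0 M 0 0 al be q - pot 0 M 0 0 al be p = M * D); last by rewrite /pot /D /xp; ring.
  apply.
  - move=> sg hsg; rewrite !mul0r !addr0 add0r.
    rewrite (_ : (1, sg) = (1, 0) + (0, sg)); last first.
      by apply: injective_projections; rewrite /= ?addr0 ?add0r.
    apply: le_trans (normD Hn _ _) _; rewrite lerD2l (norm_pair0 Hn).
    by rewrite ler_piMl// ltW.
  - by rewrite -subr_ge0 -/xp -/D ltW.
  - exact: tau.
  - by rewrite -/xp Dq -/yp -/dy /al /be /xc; field.
  - by rewrite -/xp Dq -/wp (_ : wco 0 q - wp = G + xc * dy); [rewrite /al /be /xc; field|rewrite /G /xc; ring].
have v0 : 0 < rho p / 2 * (8 * h * (h / 20) * (h * h / 20)).
  by rewrite mulr_gt0// !mulr_gt0// invr_gt0.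
apply: (@lt_le_trans _ _ (rho p / 2 * (8 * h * (h / 20) * (h * h / 20)))%:E); first by rewrite lte_fin.
apply/ereal_infP => _ [E [mE bE] <-].
rewrite EFinM -hS; apply: smooth_measure_ge => //.
  exact: subset_trans Sball bE.
exact: ltW.
Qed.

(** * Distortion coefficients at short distance *)

Lemma sinh_double (R : realType) (x : R) : sinh (x + x) = 2 * sinh x * ((expR x + expR (- x)) / 2).
Proof. by rewrite /sinh opprD !expRD; field. Qed.

(** By the duplication formulas, twice the coefficient at 1/2 is 1 / cos x or 1 / cosh x with x = th
    om / 2, which tends to 1 with th. *)
Lemma sigma_r_half (R : realType) (K M c : R) : 0 < M -> c < 1 ->
  exists2 th0 : R, 0 < th0 & forall th, 0 <= th <= th0 ->
    exists2 v : R, sigma_r K M (1 / 2) th = v%:E & c < 2 * v.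
Proof.
move=> M0 c1.
have pi0 : 0 < pi :> R by exact: pi_gt0.
pose om := Num.sqrt (`|K| / M).
have om0 : 0 <= om by exact: sqrtr_ge0.
have om2 : om ^+ 2 = `|K| / M by rewrite sqr_sqrtr// divr_ge0// ltW.
have om1 : 0 < om + 1 by rewrite ltr_wpDl.
(* The lower bound 1/2 keeps c' positive, so that the logarithm below is meaningful. *)
pose c' := Num.max c (1 / 2).
have c'1 : c' < 1 by rewrite gt_max c1; lra.
have c'0 : 0 < c' by rewrite lt_max; apply/orP; right; lra.
have cc' : c <= c' by rewrite le_max lexx.
have lc : 0 < ln c'^-1 by rewrite ln_gt0// invf_gt1.
(* The bound th om <= 1 stays below pi and avoids the infinite branch; th om <= ln (1 / c') bounds
   cosh x by 1 / c'. Dividing by om + 1 also covers K = 0. *)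
exists (Num.min 1 (ln c'^-1) / (om + 1)); first by rewrite divr_gt0// lt_min ltr01.
move=> th /andP[th0]; rewrite ler_pdivlMr// le_min => /andP[h1 h2].
have th_om : 0 <= th * om by exact: mulr_ge0.
have om_th1 : th * om <= 1 by rewrite mulrDr mulr1 in h1; lra.
have om_thl : th * om <= ln c'^-1 by rewrite mulrDr mulr1 in h2; lra.
rewrite /sigma_r; have [_|K0] := eqVneq K 0; first by exists (1/2) => //; lra.
have Kth : K * th ^+ 2 < M * pi ^+ 2.
  have h : `|K| * th ^+ 2 = M * (th * om) ^+ 2 by rewrite exprMn om2; field; rewrite gt_eqF.
  apply: (@le_lt_trans _ _ (`|K| * th ^+ 2)); first by apply: ler_wpM2r; rewrite ?sqr_ge0// ler_norm.
  rewrite h ltr_pM2l//; apply: (@le_lt_trans _ _ 1); first by rewrite expr_le1.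
  by rewrite exprn_egt1//; have := pi_ge2 R; lra.
rewrite leNgt Kth/=.
have [thE|thN] := eqVneq th 0.
  by rewrite thE expr0n/= mulr0 ltxx; exists (1/2) => //; lra.
have tp : 0 < th by rewrite lt_neqAle eq_sym thN.
have t2 : 0 < th ^+ 2 by rewrite exprn_gt0.
have K_om : 0 < om by rewrite sqrtr_gt0 divr_gt0// normr_gt0.
rewrite pmulr_lgt0//; have [Kp|Kn] := ltP 0 K.
  have -> : Num.sqrt (K / M) = om by rewrite /om gtr0_norm.
  set x := 1 / 2 * th * om.
  have -> : th * om = x *+ 2 by rewrite /x mulr2n; field.
  have x0 : 0 < x by rewrite /x !mulr_gt0.
  have xpi : x < pi / 2 by have := pi_ge2 R; move: om_th1; rewrite /x; lra.
  have sx : 0 < sin x by apply: sin_gt0_pihalf; rewrite x0.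
  have cx : 0 < cos x by apply: cos_gt0_pihalf; rewrite xpi andbT; lra.
  rewrite sin_mulr2n; exists (sin x / ((cos x * sin x) *+ 2)) => //.
  have -> : 2 * (sin x / ((cos x * sin x) *+ 2)) = (cos x)^-1.
    by rewrite mulr2n; field; rewrite !gt_eqF.
  apply: lt_le_trans c1 _; rewrite invf_ge1//; exact: cos_le1.
have Kn' : K < 0 by rewrite lt_neqAle K0.
have -> : Num.sqrt (- K / M) = om by rewrite /om ltr0_norm.
set x := 1 / 2 * th * om.
have -> : th * om = x + x by rewrite /x; field.
have x0 : 0 < x by rewrite /x !mulr_gt0.
have sx : 0 < sinh x.
  by rewrite /sinh divr_gt0// subr_gt0 ltr_expR; lra.
have ch : (expR x + expR (- x)) / 2 < c'^-1.
  have e1 : expR (- x) <= expR x by rewrite ler_expR; lra.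
  have e2 : expR x < c'^-1.
    rewrite -[ltRHS](lnK (_ : c'^-1 \is Num.pos)) ?posrE ?invr_gt0// ltr_expR.
    by apply: lt_le_trans om_thl; rewrite (_ : th * om = x + x); [lra|rewrite /x; field].
  by lra.
have ch0 : 0 < (expR x + expR (- x)) / 2 by rewrite divr_gt0// addr_gt0// expR_gt0.
rewrite sinh_double; exists (sinh x / (2 * sinh x * ((expR x + expR (- x)) / 2))) => //.
apply: le_lt_trans cc' _.
rewrite (_ : 2 * _ = ((expR x + expR (- x)) / 2)^-1).
  by rewrite -[ltLHS]invrK ltf_pV2// posrE invr_gt0.
by move: ch0; rewrite pmulr_lgt0// => ch0; field; rewrite !gt_eqF.
Qed.

(** Twice tau is (2 sigma)^(1 - 1/N), and q^(1/N) is the same power of q^(1/(N-1)); so sigma only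
    has to satisfy 2 sigma > q^(1/(N-1)). *)
Lemma tau_half (R : realType) (K N q : R) : 1 < N -> 0 < q < 1 ->
  exists2 th0 : R, 0 < th0 & forall th, 0 <= th <= th0 ->
    exists2 v : R, tau K N (1 / 2) th%:E = v%:E & 0 <= v /\ q `^ N^-1 < 2 * v.
Proof.
move=> N1 /andP[q0 q1].
have N0 : 0 < N by lra.
have M0 : 0 < N - 1 by lra.
have NN0 : N != 0 by rewrite gt_eqF.
have MN0 : N - 1 != 0 by rewrite gt_eqF.
have cq1 : q `^ (N - 1)^-1 < 1.
  have p1 : 1 `^ (N - 1)^-1 = 1 :> R by rewrite powR1.
  rewrite -[ltRHS]p1; apply: gt0_ltr_powR => //.
  - by rewrite invr_gt0.
  - by rewrite nnegrE ltW.
  - by rewrite nnegrE.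
have [th0 th00 hth] := sigma_r_half K M0 cq1.
exists th0 => // th /hth[v hv qv].
have q'0 : 0 < q `^ (N - 1)^-1 by exact: powR_gt0.
have v0 : 0 < v by lra.
exists ((1 / 2) `^ N^-1 * v `^ (1 - N^-1)).
  by rewrite /tau /sigma hv poweR_EFin EFinM.
split; first by rewrite mulr_ge0// powR_ge0.
have e0 : 0 < 1 - N^-1 by rewrite subr_gt0 invf_lt1.
have -> : 2 * ((1 / 2) `^ N^-1 * v `^ (1 - N^-1)) = (2 * v) `^ (1 - N^-1).
  rewrite [RHS]powRM ?ltW// mulrA; congr (_ * _).
  rewrite div1r -powR_inv1// -powRrM mulN1r powRN powRB ?powRr1//.
  by apply/implyP => _; rewrite pnatr_eq0.
have -> : q `^ N^-1 = (q `^ (N - 1)^-1) `^ (1 - N^-1).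
  by rewrite -powRrM; congr (_ `^ _); field; rewrite NN0 MN0.
apply: gt0_ltr_powR => //.
- by rewrite nnegrE powR_ge0.
- by rewrite nnegrE mulr_ge0// ltW.
Qed.

(** * The contradiction near the identity *)

Lemma dist_AB_le (R : realType) (nrm : R * R -> R) (cx s c0 c1 k r : R) (p q : R * R * R) :
  is_norm nrm -> window_data nrm cx s c0 c1 k r -> boxA s r p -> boxB s r q ->
  (sF_dist nrm p q <= (21 / 10 * cx)%:E)%E.
Proof.
move=> Hn HW pA qB; have [[cx0 k0 r0 hc1 hkr] hx [hnr hc0] hU hL] := HW.
have [al [be [h1 _ h2 _ _]]] := dist_AB Hn HW pA qB.
apply: le_trans h1 _; rewrite lee_fin; apply: le_trans h2 _.
have [xp yp _] := pA; have [xq yq _] := qB.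
have hdy : `|yco s q - yco s p| <= 2 * (r / 100).
  by move: yp yq; rewrite !ler_norml; clear => /andP[? ?] /andP[? ?]; apply/andP; split; lra.
have [D1 D2] : 0 <= q.1.1 - p.1.1 /\ q.1.1 - p.1.1 <= 101 / 50.
  by move: xp xq; rewrite !ler_norml opprK; clear => /andP[? ?] /andP[? ?]; split; lra.
have k1 : c0 * (q.1.1 - p.1.1) <= cx * (101 / 100) * (101 / 50).
  by apply: ler_pM => //; move: hc0; clear -cx0 => /andP[? ?]; lra.
have k2 := absM hc1 hdy; have k3 := ler_norm (c1 * (yco s q - yco s p)).
have k4 : 0 <= nrm (0, 1) * r by rewrite mulr_ge0 ?(norm_ge0 Hn)// ltW.
by move: k1 k2 k3 k4 hnr; clear -cx0; lra.
Qed.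

(** The infimum used for K >= 0 and the supremum used for K < 0 obey the same bounds, so the sign of
    K matters no further. *)
Lemma Theta_bounds (R : realType) (d : R * R * R -> R * R * R -> \bar R) (K c : R)
    (A B : set (R * R * R)) : A !=set0 -> B !=set0 ->
  (forall p q, A p -> B q -> (0 <= d p q <= c%:E)%E) ->
  exists2 th : R, Theta d K A B = th%:E & 0 <= th <= c.
Proof.
move=> [a Aa] [b Bb] h; have /andP[h1 h2] := h a b Aa Bb.
suff /andP[t0 tc] : (0 <= Theta d K A B <= c%:E)%E.
  have tf : Theta d K A B \is a fin_num by rewrite ge0_fin_numE//; apply: le_lt_trans tc (ltey _).
  by exists (fine (Theta d K A B)); rewrite ?fineK// -!lee_fin fineK// t0.
rewrite /Theta; case: ifP => _; apply/andP; split.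
- by apply/ereal_infP => _ [p Ap [q Bq <-]]; have /andP[] := h p q Ap Bq.
- by apply: le_trans h2; apply: ereal_inf_lbound; exists a => //; exists b.
- by apply: le_trans h1 _; apply: ereal_sup_ubound; exists a => //; exists b.
- by apply: ge_ereal_sup => _ [p Ap [q Bq <-]]; have /andP[] := h p q Ap Bq.
Qed.

Lemma dil_box_small (R : realType) (s x0 sg dx dy dw b l : R) p : 0 < l <= 1 ->
  `|x0| + dx <= 2 -> `|sg| <= 1 -> dy <= b -> dw <= b -> 0 <= b ->
  box s (l * x0) (l * sg) (l * dx) (l * dy) (l ^+ 2 * dw) p ->
  let C := 2 + 2 * `|s| + 4 * b in
  [/\ `|p.1.1| <= l * C, `|p.1.2| <= l * C & `|p.2| <= l * C].
Proof.
move=> /andP[l0 l1] hx hsg hdy hdw b0.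
have lN0 : l != 0 by rewrite gt_eqF.
have -> : p = dil l (dil l^-1 p).
  by rewrite -[X in dil X (dil _ _)](invrK l) dilK// invr_eq0.
move: (dil l^-1 p) => {}p /(box_dil _ _ _ _ _ _ _ l0) [b1 b2 b3] C.
have s0 := normr_ge0 s.
rewrite /dil /= !(normrM l) (normrM (l ^+ 2)) (gtr0_norm l0) !ler_pM2l//.
have x1 : `|p.1.1| <= 2.
  apply: le_trans hx; rewrite -[p.1.1](subrK x0) addrC.
  by apply: le_trans (ler_normD _ _) _; rewrite lerD2l.
have y1 : `|yco s p| <= b by exact: le_trans hdy.
have w1 : `|wco s p - sg * yco s p| <= b by exact: le_trans hdw.
split; first by rewrite /C; lra.
  rewrite (_ : p.1.2 = yco s p + s * p.1.1); last by rewrite /yco; ring.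
  by apply: le_trans (ler_normD _ _) _; have := absM (lexx `|s|) x1; rewrite /C; lra.
rewrite gtr0_norm ?exprn_gt0// expr2 -mulrA ler_pM2l//.
apply: (@le_trans _ _ (1 * C)); last by rewrite mul1r.
apply: ler_pM => //; first exact: ltW.
rewrite (_ : p.2 = wco s p - sg * yco s p + sg * yco s p - p.1.1 * yco s p / 2); last by rewrite /wco; field.
have k1 := absM hsg y1; have k2 := absM x1 y1.
rewrite /C; move: w1 k1 k2 b0 s0; rewrite !ler_norml; clear => /andP[? ?] /andP[? ?] /andP[? ?] ? ?.
by apply/andP; split; lra.
Qed.

Lemma le_poweR (R : realType) (x y : \bar R) (r : R) : 0 <= r -> (0 <= x)%E -> (x <= y)%E ->
  (poweR x r <= poweR y r)%E.
Proof.
move=> r0 x0 xy; apply: gt0_ler_poweR => //; rewrite in_itv/= leey andbT//.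
exact: le_trans xy.
Qed.

Theorem theorem6p2 (R : realType) (nrm : R * R -> R) (rho : R * R * R -> R) :
  is_norm nrm -> norm_C1 nrm -> norm_strongly_convex nrm ->
  smooth rho -> (forall p, 0 < rho p) ->
  forall K N : R, 1 < N ->
    ~ BM (sF_dist nrm) (smooth_measure rho) K N.
Proof.
move=> Hn HC HS srho rho0 K N N1 bm.
have crho : continuous rho by have [] := srho [::].
have [cx [s [c0 [c1 [k [r HW]]]]]] := window_data_exists Hn HC HS.
have [[cx0 k0 r0 _ _] _ _ _ _] := HW.
have N0 : 0 < N by lra.
(* The midpoint set will have outer measure at most 4/5 w, with w a lower bound for the measures of
   both boxes; so the inequality fails once 2 tau > (4/5)^(1/N). *)
have q01 : 0 < (4 / 5 : R) < 1 by lra.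
have [th0 th00 hth] := tau_half K N1 q01.
have o10 : 0 < rho 0 / 10 by rewrite divr_gt0.
have [dl dl0 hdl] := continuous_at_box (crho 0) o10.
pose C := 2 + 2 * `|s| + 4 * (r / 100).
have C0 : 0 < C by rewrite /C; have := normr_ge0 s; lra.
(* Small enough for rho to vary by at most a tenth on the boxes and for all distances between A and
   B to be below th0. *)
pose l := Num.min 1 (Num.min (dl / (2 * C)) (th0 / (21 / 10 * cx))).
have cx1 : 0 < 21 / 10 * cx by lra.
have l0 : 0 < l by rewrite !lt_min ltr01 !divr_gt0// mulr_gt0.
have l1 : 0 < l <= 1 by rewrite l0 ge_min lexx.
have lC : l * C < dl.
  have : l * (2 * C) <= dl by rewrite -ler_pdivlMr ?mulr_gt0// /l !ge_min lexx !orbT.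
  by have := mulr_gt0 l0 C0; lra.
have lth : l * (21 / 10 * cx) <= th0 by rewrite -ler_pdivlMr// /l !ge_min lexx !orbT.
pose A := box s (l * -1) (l * -(1 / 2)) (l * (1 / 100)) (l * (r / 100)) (l ^+ 2 * (r / 100 / 12)).
pose B := box s (l * 1) (l * (1 / 2)) (l * (1 / 100)) (l * (r / 100)) (l ^+ 2 * (r / 100 / 12)).
pose E := box s (l * 0) (l * 0) (l * (11 / 10 / 100)) (l * (9 / 20 * (r / 100))) (l ^+ 2 * (13 / 10 * (r / 100 / 12))).
have lN0 : l != 0 by rewrite gt_eqF.
have li0 : 0 < l^-1 by rewrite invr_gt0.
have dilK' p : dil l (dil l^-1 p) = p.
  by rewrite -[X in dil X (dil _ _)](invrK l) dilK// invr_eq0.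
have toA p : A p -> boxA s r (dil l^-1 p).
  by rewrite -{1}(dilK' p) => /(box_dil _ _ _ _ _ _ _ l0).
have toB p : B p -> boxB s r (dil l^-1 p).
  by rewrite -{1}(dilK' p) => /(box_dil _ _ _ _ _ _ _ l0).
have dAB p q : A p -> B q -> (0 <= sF_dist nrm p q <= (l * (21 / 10 * cx))%:E)%E.
  move=> /toA pA /toB qB; rewrite sF_dist_ge0//= -(dilK' p) -(dilK' q) sF_dist_dil//.
  by rewrite EFinM lee_pmul2l ?lte_fin//; exact: dist_AB_le HW pA qB.
have near x0 sg dx dy dw p : `|x0| + dx <= 2 -> `|sg| <= 1 -> dy <= r / 100 -> dw <= r / 100 ->
    box s (l * x0) (l * sg) (l * dx) (l * dy) (l ^+ 2 * dw) p -> `|rho p - rho 0| < rho 0 / 10.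
  move=> h1 h2 h3 h4 bp.
  have [|t1 t2 t3] := dil_box_small l1 h1 h2 h3 h4 _ bp; first by clear -r0; lra.
  by apply: hdl; rewrite /= subr0; apply: le_lt_trans lC.
have A0 : A !=set0.
  exists (dil l (-1, - s, 0)); apply/(box_dil _ _ _ _ _ _ _ l0).
  rewrite /box /wco /yco /=; split.
  - by rewrite subrr normr0; clear; lra.
  - by rewrite mulrN1 opprK addNr normr0; clear -r0; lra.
  - by rewrite mulrN1 opprK addNr !mulr0 mul0r addr0 subr0 normr0; clear -r0; lra.
have B0 : B !=set0.
  exists (dil l (1, s, 0)); apply/(box_dil _ _ _ _ _ _ _ l0).
  rewrite /box /wco /yco /=; split.
  - by rewrite subrr normr0; clear; lra.
  - by rewrite mulr1 subrr normr0; clear -r0; lra.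
  - by rewrite mulr1 subrr !mulr0 mul0r addr0 subr0 normr0; clear -r0; lra.
have sptT S : S `<=` spt (sF_dist nrm) (smooth_measure rho) by move=> p _; exact: (spt_full rho0 Hn (crho p)).
have t01 : 0 < (1 / 2 : R) < 1 by clear; lra.
have := bm A B (measurable_box _ _ _ _ _ _) (measurable_box _ _ _ _ _ _) A0 B0 (sptT _) (sptT _) _ t01.
have [th -> /andP[th1 th2]] := Theta_bounds K A0 B0 dAB.
have [|v tv [v0 qv]] := hth th; first by rewrite th1 (le_trans th2).
rewrite (_ : 1 - 1 / 2 = 1 / 2); last by clear; lra.
rewrite tv; apply/negP; rewrite -ltNge.
pose V := 8 * (l * (1 / 100)) * (l * (r / 100)) * (l ^+ 2 * (r / 100 / 12)).
have V0 : 0 < V by rewrite /V !mulr_gt0 ?exprn_gt0 ?divr_gt0// invr_gt0.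
pose w := rho 0 * (9 / 10) * V.
have w0 : 0 < w by rewrite /w !mulr_gt0// invr_gt0.
have h12 : r / 100 / 12 <= r / 100 by clear -r0; lra.
have h2 : 1 + 1 / 100 <= 2 :> R by clear; lra.
have lower x0 sg : `|x0| = 1 -> `|sg| <= 1 -> (w%:E <= smooth_measure rho
    (box s (l * x0) (l * sg) (l * (1 / 100)) (l * (r / 100)) (l ^+ 2 * (r / 100 / 12))))%E.
  move=> hx0 hsg; rewrite /w EFinM /V.
  rewrite -(@volume_box _ s (l * x0) (l * sg)); last 3 first.
  - by apply: mulr_ge0; [exact: ltW|clear; lra].
  - by apply: mulr_ge0; [exact: ltW|clear -r0; lra].
  - by apply: mulr_ge0; [exact: sqr_ge0|clear -r0; lra].
  apply: smooth_measure_ge => //; first exact: measurable_box.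
    by rewrite mulr_ge0// ltW.
  move=> p bp; have := near x0 sg (1 / 100) (r / 100) (r / 100 / 12) p.
  rewrite hx0 ltr_norml => /(_ h2 hsg (lexx _) h12 bp) /andP[+ _].
  by clear; lra.
have upper : (outer (smooth_measure rho) (Mt (sF_dist nrm) (1 / 2) A B) <= (4 / 5 * w)%:E)%E.
  have ME : Mt (sF_dist nrm) (1 / 2) A B `<=` E.
    move=> x [g [geo /toA gA /toB gB ->]].
    rewrite -(dilK' (g (1 / 2))); apply/(box_dil _ _ _ _ _ _ _ l0).
    have D p q : sF_dist nrm (dil l^-1 p) (dil l^-1 q) = (l^-1%:E * sF_dist nrm p q)%E.
      exact: sF_dist_dil.
    have df : sF_dist nrm (dil l^-1 (g 0)) (dil l^-1 (g 1)) \is a fin_num.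
      rewrite ge0_fin_numE ?sF_dist_ge0//.
      by apply: le_lt_trans (dist_AB_le Hn HW gA gB) (ltey _).
    have half : `|1 / 2 - 0| = 1 / 2 :> R by rewrite subr0 ger0_norm//; clear; lra.
    have half' : `|1 - 1 / 2| = 1 / 2 :> R by rewrite ger0_norm; clear; lra.
    (* A geodesic at time 1/2 halves the distance exactly; dilating by 1 / l returns to the boxes of
       fixed size. *)
    apply: (midpoint_box Hn HW gA gB (dv := fine (sF_dist nrm (dil l^-1 (g 0)) (dil l^-1 (g 1))))).
    - by rewrite fineK.
    - rewrite D geo ?lexx ?ler01//; last by clear; lra.
      by rewrite half muleCA -D -{1}(fineK df) -EFinM; congr EFin; field.
    - rewrite D geo ?lexx ?ler01//; last by clear; lra.
      by rewrite half' muleCA -D -{1}(fineK df) -EFinM; congr EFin; field.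
  apply: (@le_trans _ _ (smooth_measure rho E)).
    by apply: ereal_inf_lbound; exists E => //; split => //; exact: measurable_box.
  apply: (@le_trans _ _ ((rho 0 * (11 / 10))%:E * Leb3 E)%E).
    apply: smooth_measure_le => //; first exact: measurable_box.
    move=> p bp; have := near 0 0 (11 / 10 / 100) (9 / 20 * (r / 100)) (13 / 10 * (r / 100 / 12)) p.
    have e1 : 0 + 11 / 10 / 100 <= 2 :> R by clear; lra.
    have e2 : 9 / 20 * (r / 100) <= r / 100 by clear -r0; lra.
    have e3 : 13 / 10 * (r / 100 / 12) <= r / 100 by clear -r0; lra.
    by rewrite normr0 ltr_norml => /(_ e1 ler01 e2 e3 bp) /andP[_]; clear; lra.
  rewrite volume_box; last 3 first.
  - by apply: mulr_ge0; [exact: ltW|clear; lra].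
  - by apply: mulr_ge0; [exact: ltW|clear -r0; lra].
  - by apply: mulr_ge0; [exact: sqr_ge0|clear -r0; lra].
  rewrite -EFinM lee_fin.
  (* Density 11/10 times the volume ratio 11/10 * 9/20 * 13/10 is about 0.708, below 4/5 * 9/10 =
     0.72. *)
  rewrite (_ : rho 0 * _ * _ = rho 0 * V * (11 / 10 * (11 / 10 * (9 / 20) * (13 / 10)))); last by rewrite /V; field.
  by rewrite /w; have := mulr_gt0 (rho0 0) V0; clear; lra.
have Ni : 0 <= N^-1 by rewrite invr_ge0 ltW.
have o0 : (0 <= outer (smooth_measure rho) (Mt (sF_dist nrm) (1 / 2) A B))%E.
  by apply/ereal_infP => _ [F _ <-]; apply: integral_ge0 => p _; rewrite lee_fin ltW.
apply: le_lt_trans (le_poweR Ni o0 upper) _.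
have wp : 0 < w `^ N^-1 by exact: powR_gt0.
apply: (@lt_le_trans _ _ (v * w `^ N^-1 + v * w `^ N^-1)%:E).
  rewrite poweR_EFin lte_fin powRM ?ltW//.
  by rewrite (_ : v * _ + _ = 2 * v * w `^ N^-1); [rewrite ltr_pM2r|ring].
have w00 : (0 <= w%:E)%E by rewrite lee_fin ltW.
have sg1 : `|1 / 2| <= 1 :> R by rewrite ger0_norm; clear; lra.
have sgN1 : `|- (1 / 2)| <= 1 :> R by rewrite normrN.
have mA := le_poweR Ni w00 (lower _ _ (normrN1 _) sgN1).
have mB := le_poweR Ni w00 (lower _ _ (normr1 _) sg1).
by rewrite EFinD EFinM -poweR_EFin; apply: leeD; apply: lee_wpmul2l; rewrite ?lee_fin.
Qed.
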